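(* The following optimization problem can be solved in polynomial time: given a finite set $X$ of strings over an alphabet, find a schedule $\mathcal S$ of $X$ minimizing $\sum_{B\in\mathcal S}|\mathcal C(B)|$, where $|\mathcal C(B)|$ is the number of phrases in the run length encoding of the concatenation of the strings of batch $B$ in their batch order.
   Context: A batch of $X$ is an ordered subset of $X$ (a sequence of distinct elements), identified with the concatenation of its strings in order; a schedule of $X$ is a partition of $X$ into batches. Run length encoding parses a string into maximal runs of a single repeated character, each run encoded as a phrase $(\sigma,n)$ (character $\sigma$ repeated $n$ times); the number of phrases is the number of maximal runs. *)

(* Defs.v *)
From mathcomp Require Import all_boot.
Set Implicit Arguments. Unset Strict Implicit. Unset Printing Implicit Defensive.

(* Strings over the alphabet nat (an arbitrary countable alphabet). *)
Definition str := seq nat.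

Fixpoint rle (s : str) : seq (nat * nat) :=
  match s with
  | [::] => [::]
  | x :: t =>
      match rle t with
      | (y, n) :: r => if x == y then (y, n.+1) :: r else (x, 1) :: (y, n) :: r
      | [::] => [:: (x, 1)]
      end
  end.

Definition batch_cost (B : seq str) : nat := size (rle (flatten B)).

Definition sched_cost (S : seq (seq str)) : nat := \sum_(B <- S) batch_cost B.

(* S is a schedule of X (X given as a duplicate-free list): a partition of X
   into nonempty batches, each an ordered sequence of distinct elements. *)
Definition is_schedule (X : seq str) (S : seq (seq str)) : Prop :=
  all (fun B => B != [::]) S /\ perm_eq (flatten S) X.

Definition optimal_schedule (X : seq str) (S : seq (seq str)) : Prop :=
  is_schedule X S /\
  forall S', is_schedule X S' -> sched_cost S <= sched_cost S'.

Inductive sym := S0 | S1 | SComma | SSemi | SBar.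

Fixpoint bits_aux (fuel n : nat) : seq bool :=
  match fuel with
  | 0 => [::]
  | f.+1 => if n == 0 then [::] else odd n :: bits_aux f n./2
  end.
(* binary representation, least significant bit first; 0 is empty *)
Definition bits (n : nat) : seq bool := bits_aux n n.

Definition enc_nat (n : nat) : seq sym := map (fun b : bool => if b then S1 else S0) (bits n).
Definition enc_str (s : str) : seq sym := flatten [seq enc_nat c ++ [:: SComma] | c <- s].
Definition enc_list (X : seq str) : seq sym := flatten [seq enc_str s ++ [:: SSemi] | s <- X].
Definition enc_sched (S : seq (seq str)) : seq sym :=
  flatten [seq enc_list B ++ [:: SBar] | B <- S].

Inductive move := MoveL | MoveR | Stay.

(* Tape cells: None = blank, Some (inl s) = an input/output symbol,
   Some (inr w) = a work symbol from a finite set W. *)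
Record TM : Type := {
  tm_Q : finType;
  tm_W : finType;
  tm_q0 : tm_Q;
  tm_halt : tm_Q -> bool;
  tm_delta : tm_Q -> option (sym + tm_W) -> tm_Q * option (sym + tm_W) * move
}.

Definition cell (M : TM) := option (sym + tm_W M).

(* configuration: state, left part (reversed, nearest cell first), head cell, right part *)
Definition config (M : TM) := (tm_Q M * seq (cell M) * cell M * seq (cell M))%type.

Definition tm_step (M : TM) (c : config M) : config M :=
  let: (q, l, h, r) := c in
  if tm_halt q then c else
  let: (q', w, m) := tm_delta q h in
  match m with
  | Stay => (q', l, w, r)
  | MoveL => match l with
             | [::] => (q', [::], None, w :: r)
             | x :: l' => (q', l', x, w :: r)
             end
  | MoveR => match r with
             | [::] => (q', w :: l, None, [::])
             | x :: r' => (q', w :: l, x, r')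
             end
  end.

Definition tm_init (M : TM) (inp : seq sym) : config M :=
  match inp with
  | [::] => (@tm_q0 M, [::], None, [::])
  | x :: t => (@tm_q0 M, [::], Some (inl x), map (fun y => Some (inl y)) t)
  end.

Definition tm_run (M : TM) (t : nat) (c : config M) : config M := iter t (@tm_step M) c.

Definition tm_halted (M : TM) (c : config M) : bool :=
  let: (q, _, _, _) := c in tm_halt q.

Definition tm_output (M : TM) (c : config M) : seq sym :=
  let: (_, l, h, r) := c in
  pmap (fun x : cell M => if x is Some (inl s) then Some s else None)
       (rev l ++ h :: r).

Definition solves_schedule_in_poly_time (M : TM) : Prop :=
  exists a k : nat,
    forall X : seq str, uniq X ->
      exists t : nat,
        t <= a * (size (enc_list X)).+1 ^ k /\
        tm_halted (tm_run t (tm_init M (enc_list X))) /\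
        exists S : seq (seq str),
          tm_output (tm_run t (tm_init M (enc_list X))) = enc_sched S /\
          optimal_schedule X S.

(* Main.v *)
From HB Require Import structures.
From Stdlib Require Import FunctionalExtensionality.
Require Import Defs.
From mathcomp Require Import all_boot zify.
Set Implicit Arguments. Unset Strict Implicit. Unset Printing Implicit Defensive.

(** The comparison with an arbitrary order must respect multiplicities. Degrees provide starts at
    [v] itself, but a closed trail only guarantees some start on its vertices, at an unknown place,
    which could already serve another start. This clash is excluded because the vertex sets of
    closed trails are sets that no edge crosses, and such sets are stable under intersection. Five
    blocks suffice: to splice a closed trail in elsewhere, it is cut in two at the shared vertex,
    and only these two pieces and the stretch between the trail and the splice point move. The
    number of rounds is linear because the cost never exceeds the length of the input, so a copy of
    the input serves as a unary round counter. *)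

(* Splitting a batch never removes a phrase boundary, so an optimal schedule may be taken
   to be a single batch.  A nonempty string acts as an edge from its first to its last
   character, and an order of the strings costs a constant plus the number of positions
   where the walk has to restart.  Local search with the move A B C D E -> A D C B E on five
   consecutive blocks reaches a global optimum: if no move improves, then at every vertex v
   where a trail starts, either no trail ends (and the degrees force as many starts at v in
   any order), or a closed trail sits at v which shares no vertex with the remaining strings
   (and any order needs a start on that closed trail).  A round tries all polynomially many
   decompositions, and each round before the last lowers the cost.

   The search is a structured program on stacks of symbols.  A Turing machine simulates
   the stacks as parallel tracks whose tops are aligned at the left end of the tape;
   pushing and popping shift one track by a sweep. *)

(** * Walks through a list of edges *)

(** [p] is the vertex reached before [L], or [None] if the walk has not begun. Carrying it makes the
    count additive over concatenation, with [target] as the new [p]. *)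
Fixpoint starts (p : option nat) (L : seq (nat * nat)) : seq nat :=
  if L is e :: L' then (if p == Some e.1 then [::] else [:: e.1]) ++ starts (Some e.2) L'
  else [::].

Fixpoint ends (p : option nat) (L : seq (nat * nat)) : seq nat :=
  if L is e :: L' then (if p == Some e.1 then [::] else seq_of_opt p) ++ ends (Some e.2) L'
  else seq_of_opt p.

Fixpoint target (p : option nat) (L : seq (nat * nat)) : option nat :=
  if L is e :: L' then target (Some e.2) L' else p.

Definition source (L : seq (nat * nat)) : option nat := omap fst (ohead L).

(** Blocks may be empty, so this includes exchanging two adjacent blocks. *)
Definition locally_optimal (L : seq (nat * nat)) : Prop :=
  forall A B C D E, L = A ++ B ++ C ++ D ++ E ->
    size (starts None L) <= size (starts None (A ++ D ++ C ++ B ++ E)).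

Lemma target_cat p A B : target p (A ++ B) = target (target p A) B.
Proof. by elim: A p => //= e A IH p. Qed.

Lemma starts_cat p A B : starts p (A ++ B) = starts p A ++ starts (target p A) B.
Proof. by elim: A p => //= e A IH p; rewrite IH catA. Qed.

Lemma size_starts_cons p e L :
  size (starts p (e :: L)) = (p != Some e.1) + size (starts (Some e.2) L).
Proof. by rewrite /= size_cat; case: eqP. Qed.

Lemma size_starts_cat p A B :
  size (starts p (A ++ B)) = size (starts p A) + size (starts (target p A) B).
Proof. by rewrite starts_cat size_cat. Qed.

(** Degree balance at [v]: an arrival that is not an end is continued by a departure that is not a
    start. [p] counts as an arrival. *)
Lemma count_starts_ends v p L :
  count_mem v (starts p L) + (p == Some v) + count_mem v (map snd L) =
  count_mem v (ends p L) + count_mem v (map fst L).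
Proof.
elim: L p => [|e L IH] p /=; first by case: p => [x|] /=; rewrite ?(inj_eq Some_inj); lia.
have := IH (Some e.2); rewrite !count_cat (inj_eq Some_inj).
case: (p =P Some e.1) => [->|hp] /=; first by rewrite (inj_eq Some_inj); lia.
by case: p hp => [x|] hp /=; rewrite ?(inj_eq Some_inj); lia.
Qed.

Lemma mem_starts v p L : v \in starts p L ->
  exists S1 f S2, [/\ L = S1 ++ f :: S2, f.1 = v & target p S1 <> Some v].
Proof.
elim: L p => //= e L IH p; rewrite mem_cat; case/orP.
  by case: eqP => //= hp; rewrite inE => /eqP->; exists [::], e, L.
by move=> /IH[S1 [f [S2 [-> hf ht]]]]; exists (e :: S1), f, S2.
Qed.

Lemma mem_ends v p L : v \in ends p L ->
  (p = Some v /\ source L <> Some v) \/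
  exists E1 e E2, [/\ L = E1 ++ e :: E2, e.2 = v & source E2 <> Some v].
Proof.
elim: L p => [|e L IH] p /=.
  by case: p => //= x; rewrite inE => /eqP->; left.
rewrite mem_cat; case/orP.
  case: eqP => //= hp; case: p hp => //= x hp; rewrite inE => /eqP vx; left.
  by split; rewrite ?vx // /source /= => eq; apply: hp; rewrite eq.
move=> /IH[[[ev] hs]|[E1 [f [E2 [-> hf hs]]]]]; right.
  by exists [::], e, L.
by exists (e :: E1), f, E2.
Qed.

Lemma cat_eq_cat (T : Type) (A B C D : seq T) : A ++ B = C ++ D ->
  (exists R, A = C ++ R /\ D = R ++ B) \/ (exists R, C = A ++ R /\ B = R ++ D).
Proof.
elim: A C => [|a A IH] [|c C] /=.
- by move=> ->; left; exists [::].
- by move=> ->; right; exists (c :: C).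
- by move=> <-; left; exists (a :: A).
- by case=> -> /IH[[R [-> ->]]|[R [-> ->]]]; [left|right]; exists R.
Qed.

Lemma starts_nil p : starts p [::] = [::].
Proof. by []. Qed.

Arguments starts : simpl never.

(** A trail ending at [v] and a different trail starting at [v] could be joined by a move, saving a
    start. What remains is one trail from [v] back to [v]. *)
Lemma closed_block L v : locally_optimal L ->
  v \in starts None L -> v \in ends None L ->
  exists S1 f M E2, [/\ L = S1 ++ (f :: M) ++ E2, f.1 = v, target (Some f.2) M = Some v,
    starts (Some f.2) M = [::] & target None S1 <> Some v /\ source E2 <> Some v].
Proof.
move=> lo /mem_starts[S1 [f [S2 [defL fv tS1]]]] /mem_ends[[]//|].
move=> [E1 [e [E2 [defL' ev sE2]]]].
have : S1 ++ f :: S2 = (E1 ++ [:: e]) ++ E2 by rewrite -defL -catA.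
case/cat_eq_cat=> -[R [defR1 defR2]].
  (* the end precedes the start: bring the tail beginning with f right after e *)
  case: R defR1 defR2 => [|g R] defR1 defR2.
    by case: tS1; rewrite defR1 cats0 target_cat /= ev.
  have := lo (E1 ++ [:: e]) (g :: R) [::] (f :: S2) [::].
  rewrite cats0 /= defL' defR2 -catA => /(_ erefl).
  rewrite !(size_starts_cat, target_cat, size_starts_cons) /=.
  have -> : Some e.2 != Some g.1.
    by apply/eqP => h; apply: sE2; rewrite defR2 /source /= -h ev.
  have -> : target (Some g.2) R != Some f.1.
    by apply/eqP => h; apply: tS1; rewrite defR1 !target_cat /= h fv.
  by rewrite ev fv eqxx /=; case: eqP => _ /=; lia.
case: R defR1 defR2 => [|g M] defR1 defR2.
  by case: tS1; rewrite cats0 in defR1; rewrite -defR1 target_cat /= ev.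
case: defR2 => eqg defS2; subst g.
have tM : target (Some f.2) M = Some v.
  have : target None (E1 ++ [:: e]) = Some v by rewrite target_cat /= ev.
  by rewrite defR1 target_cat.
exists S1, f, M, E2; split=> //; first by rewrite defL defS2.
case defst : starts => [//|u us].
have /mem_starts[Q [g [R [defM gu tQ]]]] : u \in starts (Some f.2) M.
  by rewrite defst mem_head.
(* a break inside the block: exchanging its two parts closes the block up at v *)
have := lo S1 (f :: Q) [::] (g :: R) E2.
rewrite /= defL defS2 defM -!catA /= => /(_ erefl).
move: tM; rewrite defM target_cat /= => tM.
rewrite !(size_starts_cat, target_cat, size_starts_cons) /= tM fv gu.
move/eqP: tS1 => ->; move/eqP: tQ => ->; rewrite eqxx /=.
case: E2 sE2 {defL' defR1 defS2} => [|h E2] sE2; last first.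
  rewrite !size_starts_cons.
  have -> : Some v != Some h.1 by apply/eqP => eq; apply: sE2; rewrite /source /= -eq.
  by do 2 case: eqP => _ /=; lia.
by rewrite /=; case: eqP => _ /=; lia.
Qed.

Lemma split_mem (T : eqType) (x : T) (s : seq T) : x \in s -> exists s1 s2, s = s1 ++ x :: s2.
Proof. by case/splitPr => s1 s2; exists s1, s2. Qed.

(* If g met the closed block, the block could be rotated to the shared vertex and spliced next to g. *)
Lemma closed_block_isolated S1 f M E2 v g w :
  locally_optimal (S1 ++ (f :: M) ++ E2) -> f.1 = v -> target (Some f.2) M = Some v ->
  starts (Some f.2) M = [::] -> target None S1 <> Some v -> source E2 <> Some v ->
  g \in S1 ++ E2 -> w \in map fst (f :: M) -> (g.1 != w) && (g.2 != w).
Proof.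
move=> lo fv tM sM tS1 sE2 gin win.
(* The closed trail is cut at [w]: read as [c :: C2] followed by [C1], it is a closed trail at [w]
   instead of [v]. *)
have [C1 [c [C2 [defM cw]]]] : exists C1 c C2, f :: M = C1 ++ c :: C2 /\ c.1 = w.
  by case/mapP: win => c /split_mem[C1 [C2 ->]] ->; exists C1, c, C2.
have : size (starts (Some v) (f :: M)) = 0 by rewrite size_starts_cons fv eqxx sM.
have : target None (f :: M) = Some v by [].
have : source (f :: M) = Some v by rewrite /source /= fv.
rewrite defM => {tM sM}.
rewrite target_cat size_starts_cat size_starts_cons cw /= => sf tC s0.
have sC1 : size (starts (Some v) C1) = 0 by lia.
have tC1 : target (Some v) C1 = Some w by move: s0; case: eqP => //=; lia.
have sC2 : size (starts (Some c.2) C2) = 0 by lia.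
rewrite defM in lo; rewrite /source in sf.
rewrite -negb_or; apply/negP => gw.
move: gin; rewrite mem_cat => /orP[] /split_mem[Ta [Tb eqT]].

- have dS1 : S1 = Ta ++ [:: g] ++ Tb by rewrite eqT.
  have [t tSE] : exists t, target None S1 = Some t.
    by rewrite dS1 !target_cat /=; elim: (Tb) (g) => [|a l IH] b /=; [exists b.2|apply: IH].
  have tv : Some t != Some v by apply/eqP; rewrite -tSE.
  (* After [v] the first edge of [E2] is already a start, so no other predecessor of [E2] costs
     more. *)
  have nE2 p : size (starts p E2) <= size (starts (Some v) E2).
    case: (E2) sE2 => [//|h E] sE2; rewrite !size_starts_cons.
    case: (Some v =P Some h.1) => [eq|_]; last by case: eqP => _ /=; lia.
    by case: sE2; rewrite /source /= eq.
  (* The rotated trail is put right before [g] if [g] leaves [w], and right after [g] if [g] arrives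
     at [w]. The start of [f] is saved and no other boundary gets worse. *)
  case/orP: gw => /eqP gw.
  + have := lo Ta (g :: Tb) C1 (c :: C2) E2.
    rewrite eqT -!catA => /(_ erefl).
    rewrite !(size_starts_cat, target_cat, size_starts_cons) /=.
    move: tSE; rewrite eqT target_cat /= => ->.
    have := nE2 (Some t).
    rewrite tC cw gw.
    case: (C1) tC1 sC1 sf => [[vw] _ _|c1 D /= tC1 sC1 [sC]].
      by rewrite -vw tv eqxx /= ?starts_nil /=; lia.
    by move: sC1; rewrite !size_starts_cons /= tC1 sC tv eqxx /=; lia.
  + have := lo (Ta ++ [:: g]) Tb C1 (c :: C2) E2.
    rewrite eqT -!catA => /(_ erefl).
    rewrite !(size_starts_cat, target_cat, size_starts_cons) /=.
    move: tSE; rewrite eqT target_cat /= => tSE.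
    rewrite tC cw gw.
    case: (Tb) tSE => [|b U] /= tSE.
      case: tSE tv => <-; rewrite gw => wv.
      case: (C1) tC1 sC1 sf => [[vw] _ _|c1 D /= tC1 sC1 [sC]]; first by rewrite vw eqxx in wv.
      move: sC1 (nE2 (Some w)); rewrite !size_starts_cons /= tC1 sC wv eqxx /= ?starts_nil /=. lia.
    rewrite !size_starts_cons tSE.
    have := nE2 (Some t).
    case: (C1) tC1 sC1 sf => [[vw] _ _|c1 D /= tC1 sC1 [sC]].
      by rewrite -vw tv eqxx /= ?starts_nil /=; lia.
    by move: sC1; rewrite !size_starts_cons /= tC1 sC tv eqxx /=; lia.
have nS : Some v != source (Ta ++ g :: Tb) by rewrite -eqT; apply/eqP => h; apply: sE2.
move/eqP: tS1 => tS1.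
(* The same splice to the right. Both [f] and the first edge of [E2] were starts; only one boundary
   after [S1] remains, so one start disappears. *)
case/orP: gw => /eqP gw.
+ have := lo S1 C1 (c :: C2) Ta (g :: Tb).
  rewrite eqT -!catA => /(_ erefl).
  rewrite !(size_starts_cat, target_cat, size_starts_cons) /=.
  rewrite tC cw gw.
  case: (Ta) nS => [|a U] /= nS.
    rewrite /source /= gw in nS.
    case: (C1) tC1 sC1 sf => [[vw] _ _|c1 D /= tC1 sC1 [sC]].
      by rewrite vw eqxx in nS.
    move: sC1; rewrite !size_starts_cons /= tC1 sC tS1 nS eqxx /= ?starts_nil /=. 
    by case: eqP => _ /=; lia.
  rewrite /source /= in nS.
  rewrite !size_starts_cons nS.
  case: (C1) tC1 sC1 sf => [[vw] _ _|c1 D /= tC1 sC1 [sC]].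
    by rewrite -vw (negbTE tS1) eqxx /= ?starts_nil /=; do 2 case: eqP => _ /=; lia.
  by move: sC1; rewrite !size_starts_cons /= tC1 sC tS1 eqxx /=; do 2 case: eqP => _ /=; lia.
+ have := lo S1 C1 (c :: C2) (Ta ++ [:: g]) Tb.
  rewrite eqT -!catA => /(_ erefl).
  rewrite !(size_starts_cat, target_cat, size_starts_cons) /=.
  rewrite tC cw gw.
  case: (Ta) nS => [|a U] /= nS.
    rewrite /source /= in nS.
    rewrite ?starts_nil /= nS.
    case: (C1) tC1 sC1 sf => [[vw] _ _|c1 D /= tC1 sC1 [sC]].
      by rewrite -vw tS1 eqxx /= ?starts_nil /=; case: (target None S1 != _); case: Tb {eqT nS} => [|b Tb]; rewrite ?size_starts_cons ?starts_nil; lia.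
    move: sC1; rewrite !size_starts_cons /= tC1 sC tS1 eqxx /=. 
    by case: (target None S1 != _); case: Tb {eqT nS} => [|b Tb]; rewrite ?size_starts_cons ?starts_nil /=; lia.
  rewrite /source /= in nS.
  rewrite !size_starts_cons nS.
  case: (C1) tC1 sC1 sf => [[vw] _ _|c1 D /= tC1 sC1 [sC]].
    by rewrite -vw tS1 eqxx /= ?starts_nil /=;case: (target None S1 != _); case: Tb {eqT nS} => [|b Tb]; rewrite ?size_starts_cons ?starts_nil; lia.
  move: sC1; rewrite !size_starts_cons /= tC1 sC tS1 eqxx /=.
  by case: (target None S1 != _); case: Tb {eqT nS} => [|b Tb]; rewrite ?size_starts_cons ?starts_nil /=; lia.
Qed.

(** * Vertex sets that no edge crosses, and the comparison of starts *)

Definition separated (W : seq nat) (L : seq (nat * nat)) : bool :=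
  all (fun e => (e.1 \in W) == (e.2 \in W)) L.

(** A walk outside [W] cannot enter [W] along an edge, so its first edge in [W] is a start. As
    [separated] ignores the order of the edges, this applies to every rearrangement. *)
Lemma separated_has_start W p L e :
  separated W L -> e \in L -> e.1 \in W -> (forall x, p = Some x -> x \notin W) ->
  exists2 z, z \in starts p L & z \in W.
Proof.
rewrite /separated; elim: L p => //= g L IH p /andP[/eqP gW sep] eL eW pW.
have [hp|hp] := eqVneq p (Some g.1).
  have gW1 := pW _ hp.
  move: eL; rewrite inE => /orP[/eqP eg|eL]; first by rewrite eg (negbTE gW1) in eW.
  have [x [<-]|z zs zW] := IH (Some g.2) sep eL eW; first by rewrite -gW.
  by exists z => //; rewrite /starts hp eqxx.
have [g1|g1] := boolP (g.1 \in W).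
  by exists g.1; rewrite // /starts (negbTE hp) mem_head.
move: eL; rewrite inE => /orP[/eqP eg|eL]; first by rewrite eg (negbTE g1) in eW.
have [x [<-]|z zs zW] := IH (Some g.2) sep eL eW; first by rewrite -gW.
by exists z => //; rewrite /starts (negbTE hp) inE orbC [X in X || _]zs.
Qed.

(** The image of each start is known only through an existential in [Prop]; induction on the finite
    list makes a function of it without a choice axiom. *)
Lemma finite_choice (R : nat -> nat -> Prop) (s : seq nat) :
  (forall v, v \in s -> exists u, R v u) ->
  exists phi : nat -> nat, forall v, v \in s -> R v (phi v).
Proof.
elim: s => [|x s IH] h; first by exists id.
have [phi hphi] : exists phi : nat -> nat, forall v, v \in s -> R v (phi v).
  by apply: IH => v vs; apply: h; rewrite inE vs orbT.
have [y xy] := h x (mem_head _ _).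
exists (fun v => if v == x then y else phi v) => v; rewrite inE.
by case: eqVneq => [->|_] //= /hphi.
Qed.

Lemma count1_inj (T : eqType) (W s : seq T) x y : count (mem W) s = 1 ->
  x \in s -> y \in s -> x \in W -> y \in W -> x = y.
Proof.
rewrite -size_filter; case def: (filter _ _) => [|z [|]] // _ xs ys xW yW.
have: x \in filter (mem W) s by rewrite mem_filter /= xW.
have: y \in filter (mem W) s by rewrite mem_filter /= yW.
by rewrite def !inE => /eqP-> /eqP->.
Qed.

Lemma start_is_head v p L : v \in starts p L -> exists2 e, e \in L & e.1 = v.
Proof.
by case/mem_starts => S1 [f [S2 [-> fv _]]]; exists f; rewrite // mem_cat mem_head orbT.
Qed.

(** If no trail of [L] ends at [v], the starts of [L] at [v] number exactly out-degree minus
    in-degree, a lower bound for every order. Otherwise [W] is the vertex set of the closed trail;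
    it carries one start because the trail has no break and no other edge touches [W]. *)
Lemma starts_dichotomy L L' v : locally_optimal L -> perm_eq L' L -> v \in starts None L ->
  count_mem v (starts None L) <= count_mem v (starts None L') \/
  exists W, [/\ separated W L, v \in W & count (mem W) (starts None L) = 1].
Proof.
move=> lo pL vs; have [ve|ve] := boolP (v \in ends None L); last first.
  left; have := count_starts_ends v None L; have := count_starts_ends v None L'.
  rewrite (permP (perm_map fst pL)) (permP (perm_map snd pL)) /=.
  by rewrite [count_mem v (ends None L)](count_memPn ve); lia.
right; have [S1 [f [M [E2 [defL fv tM sM [tS1 sE2]]]]]] := closed_block lo vs ve.
rewrite defL in lo; pose W := map fst (f :: M).
have iso g w : g \in S1 ++ E2 -> w \in W -> (g.1 != w) && (g.2 != w).
  exact: closed_block_isolated lo fv tM sM tS1 sE2.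
have vW : v \in W by rewrite /W /= fv mem_head.
have isoW g : g \in S1 ++ E2 -> (g.1 \notin W) && (g.2 \notin W).
  move=> gin; apply/andP; split; apply/negP => h;
  by have /andP[] := iso _ _ gin h; rewrite eqxx.
(* [W] collects first endpoints only; the second endpoint of a trail edge is the first endpoint of
   the next edge, or [v] for the last one. *)
have sinkW g : g \in f :: M -> g.2 \in W.
  case/split_mem => Q [R defM].
  have tR : target (Some g.2) R = Some v.
    by have := tM; rewrite -[target _ M]/(target None (f :: M)) defM target_cat.
  have sR : size (starts (Some g.2) R) = 0.
    have : size (starts (Some v) (f :: M)) = 0 by rewrite size_starts_cons fv eqxx sM.
    by rewrite defM size_starts_cat size_starts_cons => /eqP; rewrite !addn_eq0 => /and3P[_ _ /eqP].
  case: R tR sR defM => [[->] //|h R] _; rewrite size_starts_cons => hR defM.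
  have /eqP[->] : Some g.2 == Some h.1 by move: hR; case: (_ == _) => //=; lia.
  by rewrite /W defM !map_cat /= mem_cat !inE eqxx !orbT.
have outW p X : {subset X <= S1 ++ E2} -> count (mem W) (starts p X) = 0.
  move=> sub; apply/eqP; rewrite -leqn0 leqNgt -has_count; apply/hasPn => z /start_is_head[e eX <-].
  by have /andP[] := isoW _ (sub _ eX).
exists W; split=> //.
  rewrite /separated defL; apply/allP => g; rewrite mem_cat [_ \in _ ++ E2]mem_cat orbCA -mem_cat.
  case/orP => [gM|gin]; last by have /andP[/negbTE-> /negbTE->] := isoW _ gin.
  by rewrite (sinkW _ gM) /W (map_f fst gM).
rewrite defL 2!starts_cat 2!count_cat [count _ (starts None S1)]outW; last first.
  by move=> g gS; rewrite mem_cat gS.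
rewrite [count _ (starts _ E2)]outW; last by move=> g gE; rewrite mem_cat gE orbT.
have -> : starts (target None S1) (f :: M) = [:: v].
  by move/eqP/negbTE: tS1 => tS1; rewrite /starts fv tS1 /= -[LHS]/(v :: starts _ _) sM.
by rewrite /= vW.
Qed.

(** The starts of [L] are mapped to starts of [L'], injectively on vertices and without losing
    multiplicity. [R] offers [v] itself when [L'] has enough starts there, and otherwise a start of
    [L'] in a separated set whose only start in [L] is [v]. *)
Theorem locally_optimal_starts L L' : locally_optimal L -> perm_eq L' L ->
  size (starts None L) <= size (starts None L').
Proof.
move=> lo pL; set SL := starts None L; set SL' := starts None L'.
pose R v u := u = v /\ count_mem v SL <= count_mem v SL' \/
  u \in SL' /\ exists W, [/\ separated W L, v \in W, u \in W & count (mem W) SL = 1].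
have [|phi hphi] := @finite_choice R SL; first move=> v vs.
  have [vle|[W [sepW vW cW]]] := starts_dichotomy lo pL vs; first by exists v; left.
  have [e eL ev] := start_is_head vs.
  have [| | | |u us uW] := @separated_has_start W None L' e; rewrite ?ev ?(perm_mem pL) //.
    by rewrite /separated (perm_all _ pL).
  by exists u; right; split=> //; exists W.
(* If [phi] fixes one of the two vertices, that vertex lies in the separated set of the other, which
   carries only one start of [L]. *)
have inj : {in SL &, injective phi}.
  move=> v1 v2 v1s v2s eqphi; have := hphi _ v1s; have := hphi _ v2s; rewrite -eqphi.
  case=> [[-> _]|[us [W2 [sep2 v2W uW2 c2]]]] [[eq1 _]|[_ [W1 [sep1 v1W uW1 c1]]]].
  - by rewrite -eq1.
  - by rewrite (count1_inj c1 v1s v2s v1W) // -eqphi.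
  - by apply: (count1_inj c2 v1s v2s); rewrite // -eq1.
  have [e eL ev] := start_is_head us; rewrite (perm_mem pL) in eL.
  (* The intersection [F] is separated and contains the common image, so [L] has a start in [F];
     this start must be both [v1] and [v2]. *)
  pose F := [seq x <- W1 | x \in W2].
  have sepF : separated F L.
    move: sep1 sep2; rewrite /separated => /allP sep1 /allP sep2; apply/allP => g gL.
    by rewrite !mem_filter (eqP (sep1 _ gL)) (eqP (sep2 _ gL)).
  have uF : e.1 \in F by rewrite ev mem_filter uW1 uW2.
  have [//|z zs] := separated_has_start (p := None) sepF eL uF.
  rewrite mem_filter => /andP[zW2 zW1].
  by rewrite (count1_inj c1 v1s zs v1W zW1) (count1_inj c2 v2s zs v2W zW2).
rewrite -(size_map phi).
suff /count_subseqP[s sub /perm_size->] : forall u, count_mem u (map phi SL) <= count_mem u SL'.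
  exact: size_subseq.
move=> u; have [/mapP[v vs uv]|/count_memPn-> //] := boolP (u \in map phi SL).
have -> : count_mem u (map phi SL) = count_mem v SL.
  rewrite count_map; apply: eq_in_count => x xs /=.
  by rewrite uv; apply/eqP/eqP => [|-> //]; apply: inj.
have [[<-]|[us [W [sepW vW _ cW]]]] := hphi _ vs; first by rewrite uv.
(* Here [v] occurs only once in [SL], since [W] carries a single start of [L], so one occurrence of
   the image in [SL'] is enough. *)
rewrite (leq_trans (n := 1)) -?has_count ?has_pred1 ?uv // -cW.
by apply: sub_count => x /= /eqP->.
Qed.

(** * Phrases and walks *)

(** The preceding character [p] makes the number of phrases additive over concatenation. *)
Fixpoint runs (p : option nat) (s : seq nat) : nat :=
  if s is x :: t then (p != Some x) + runs (Some x) t else 0.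

Lemma size_rle s : size (rle s) = runs None s.
Proof.
have hd t : ohead (map fst (rle t)) = ohead t.
  by case: t => //= x t; case: (rle t) => [//|[y n] r]; case: eqP => [->|].
case: s => // x s; elim: s x => // y s IH x; have := IH y; have := hd (y :: s).
rewrite -[rle (x :: _)]/(match rle (y :: s) with (z, n) :: r =>
  if x == z then (z, n.+1) :: r else (x, 1) :: (z, n) :: r | _ => [:: (x, 1)] end).
case: (rle (y :: s)) => [|[z n] r] //= [->] eqr.
by rewrite (inj_eq Some_inj); case: eqP => _ /=; lia.
Qed.

Lemma runs_cat p s t : runs p (s ++ t) = runs p s + runs (last p (map Some s)) t.
Proof. by elim: s p => //= x s IH p; rewrite IH addnA. Qed.

Lemma runs_None p s : runs p s <= runs None s.
Proof. by case: s => //= x s; case: (p != _). Qed.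

Definition edge_of (s : str) : nat * nat := (head 0 s, last 0 s).

Definition edges (L : seq str) : seq (nat * nat) :=
  map edge_of (filter (fun s => s != [::]) L).

Lemma edges_cat A B : edges (A ++ B) = edges A ++ edges B.
Proof. by rewrite /edges filter_cat map_cat. Qed.

(** The sum does not depend on the order: after its own first character a nonempty string costs its
    phrases minus one. The missing phrase is paid exactly where the walk restarts; empty strings
    leave the walk in place. *)
Lemma runs_flatten p L : runs p (flatten L) =
  sumn (map (fun s => runs (Some (head 0 s)) s) L) + size (starts p (edges L)).
Proof.
elim: L p => //= s L IH p; rewrite runs_cat IH /edges /=.
case: s => [|x s] //=; rewrite eqxx -[map edge_of _]/(edges L).
rewrite last_map size_starts_cons /=; lia.
Qed.

(** Lifts block moves from edges to strings. Empty strings, invisible in [edges], may fall on either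
    side of a cut. *)
Lemma edges_cat_inv L A B : edges L = A ++ B ->
  exists A' B', [/\ L = A' ++ B', edges A' = A & edges B' = B].
Proof.
elim: L A => [|s L IH] A.
  by case: A B => [|//] [|//] _; exists [::], [::].
rewrite /edges /=; case: eqVneq => [->|s0] /=.
  by move/IH=> [A' [B' [-> <- <-]]]; exists ([::] :: A'), B'.
case: A => [|a A] /= => [<-|[<- /IH[A' [B' [-> <- <-]]]]].
  by exists [::], (s :: L); rewrite /edges /= s0.
by exists (s :: A'), B'; rewrite /edges /= s0.
Qed.

Definition batch_locally_optimal (L : seq str) : Prop :=
  forall A B C D E, L = A ++ B ++ C ++ D ++ E ->
    batch_cost L <= batch_cost (A ++ D ++ C ++ B ++ E).

Lemma batch_locally_optimal_le L L' :
  batch_locally_optimal L -> perm_eq L' L -> batch_cost L <= batch_cost L'.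
Proof.
move=> lo pL.
have lo_edges : locally_optimal (edges L).
  move=> A B C D E /edges_cat_inv[A' [X [defL <-]]].
  move=> /edges_cat_inv[B' [Y [defX <-]]] /edges_cat_inv[C' [Z [defY <-]]].
  move=> /edges_cat_inv[D' [E' [defZ <- <-]]].
  rewrite defZ in defY; rewrite defY in defX; rewrite defX in defL.
  have := lo _ _ _ _ _ defL; rewrite /batch_cost !size_rle !runs_flatten !edges_cat.
  by rewrite {1}defL !map_cat !sumn_cat; lia.
rewrite /batch_cost !size_rle !runs_flatten (perm_sumn (perm_map _ pL)) leq_add2l.
by apply: locally_optimal_starts => //; apply/perm_map/perm_filter.
Qed.

Lemma batch_cost_flatten S : batch_cost (flatten S) <= sched_cost S.
Proof.
rewrite /sched_cost; elim: S => [|B S IH]; first by rewrite big_nil.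
rewrite big_cons /=; apply: leq_trans (leq_add (leqnn _) IH).
rewrite /batch_cost !size_rle flatten_cat runs_cat leq_add2l; exact: runs_None.
Qed.

(** Batches are nonempty, so the empty set needs the empty schedule. *)
Definition single_batch (L : seq str) : seq (seq str) := if L is [::] then [::] else [:: L].

Lemma single_batch_optimal X L :
  (forall Y, perm_eq Y X -> batch_cost L <= batch_cost Y) -> perm_eq L X ->
  optimal_schedule X (single_batch L).
Proof.
move=> opt pL; split.
  by case: L opt pL => [|s L] opt pL; split; rewrite //= cats0.
move=> S' [_ pS']; apply: leq_trans (batch_cost_flatten S').
apply: leq_trans (opt _ pS').
by case: (L) => [|s l]; rewrite /single_batch /sched_cost ?big_nil // big_seq1.
Qed.

(** * Stack machines on a Turing machine *)

(** Makes [sym] a finite type, as required for parts of states and work symbols. *)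
Definition sym_code (a : sym) : option (bool * bool) :=
  match a with
  | S0 => None | S1 => Some (false, false) | SComma => Some (false, true)
  | SSemi => Some (true, false) | SBar => Some (true, true)
  end.

Definition sym_decode (c : option (bool * bool)) : sym :=
  match c with
  | None => S0 | Some (false, false) => S1 | Some (false, true) => SComma
  | Some (true, false) => SSemi | Some (true, true) => SBar
  end.

Lemma sym_codeK : cancel sym_code sym_decode. Proof. by case. Qed.

HB.instance Definition _ := Finite.copy sym (can_type sym_codeK).

Section StackMachine.
Variable R : finType.

(* Jumps are relative, so that code is position independent and can be concatenated. *)
Inductive instr :=
  | Push of R & sym
  | Pop of R
  | Unless of R & (option sym -> bool) & nat
  | Back of nat.

Definition store := R -> seq sym.

Definition upd (s : store) (i : R) (v : seq sym) : store := fun j => if j == i then v else s j.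

Definition istep (code : seq instr) (c : nat * store) : nat * store :=
  let: (pc, s) := c in
  match onth code pc with
  | None => c
  | Some (Push i a) => (pc.+1, upd s i (a :: s i))
  | Some (Pop i) => (pc.+1, upd s i (behead (s i)))
  | Some (Unless i P d) => (if P (ohead (s i)) then pc.+1 else pc.+1 + d, s)
  | Some (Back d) => (pc - d, s)
  end.

Lemma size_istep code n c B : (forall r, size (c.2 r) <= B) ->
  forall r, size ((iter n (istep code) c).2 r) <= B + n.
Proof.
elim: n => [|n IH] hB r /=; first by rewrite addn0.
have := IH hB; case: (iter _ _ _) => pc s /= {}IH.
have := IH r; rewrite /istep; case: onth => [[i a|i|i P d|d]|] /=; rewrite /upd //; try lia.
- case: eqP => [->|_] /=; have := IH i; lia.
- by case: eqP => [->|_] /=; rewrite ?size_behead; lia.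
Qed.

(** * Simulation of the stacks on one tape *)

Section Machine.
Variables (io : R) (code : seq instr).
Notation n := (size code).

(** A work symbol is a column with one entry per stack; [None] is the marker to the left of all
    columns. *)
Definition work := option {ffun R -> option sym}.
Definition tcell := option (sym + work).
Definition marker : tcell := Some (inr None).

(** A raw input symbol is read as a column with an entry on the track [io] only, so the input needs
    no conversion. *)
Definition dec (x : tcell) (r : R) : option sym :=
  match x with
  | Some (inl a) => if r == io then Some a else None
  | Some (inr (Some v)) => v r
  | _ => None
  end.

Definition put (x : tcell) (i : R) (c : option sym) : tcell :=
  Some (inr (Some [ffun r => if r == i then c else dec x r])).

Lemma dec_put x i c r : dec (put x i c) r = if r == i then c else dec x r.
Proof. by rewrite /= ffunE. Qed.

Lemma put_marker x i c : put x i c != marker.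
Proof. by apply/eqP. Qed.

Definition tstate := ('I_n.+1 * 'I_9 * R * option sym)%type.

Definition pos (k : nat) : 'I_n.+1 := inord (minn k n).

Lemma posE k : pos k = minn k n :> nat.
Proof. by rewrite inordK // ltnS geq_minr. Qed.

Notation mode k := (@Ordinal 9 k isT).

(* modes: 0-1 write the marker, 2 fetch, 3 push (sweep right), 4-5 pop (sweep right,
   then left), 6 return to the marker, 7 output, 8 halt *)
Definition delta (q : tstate) (x : tcell) : tstate * tcell * move :=
  let: (pc, m, i, c) := q in
  match nat_of_ord m with
  | 0 => ((pc, mode 1, i, c), x, MoveL)
  | 1 => ((pc, mode 2, i, c), marker, MoveR)
  | 2 => match onth code pc with
         | None => ((pc, mode 7, i, c), x, Stay)
         | Some (Push j a) => ((pc, mode 3, j, Some a), x, Stay)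
         | Some (Pop j) => ((pc, mode 4, j, None), x, Stay)
         | Some (Unless j P d) =>
             ((pos (if P (dec x j) then pc.+1 else pc.+1 + d), mode 2, i, c), x, Stay)
         | Some (Back d) => ((pos (pc - d), mode 2, i, c), x, Stay)
         end
  | 3 => if dec x i is Some a then ((pc, mode 3, i, Some a), put x i c, MoveR)
         else ((pos pc.+1, mode 6, i, None), put x i c, MoveL)
  | 4 => if dec x i is Some _ then (q, x, MoveR)
         else ((pc, mode 5, i, None), x, MoveL)
  | 5 => if x == marker then ((pos pc.+1, mode 2, i, None), x, MoveR)
         else ((pc, mode 5, i, dec x i), put x i c, MoveL)
  | 6 => if x == marker then ((pc, mode 2, i, None), x, MoveR) else (q, x, MoveL)
  | 7 => if dec x io is Some a then (q, Some (inl a), MoveR)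
         else ((pc, mode 8, i, c), x, Stay)
  | _ => (q, x, Stay)
  end.

Definition machine : TM :=
  {| tm_Q := tstate; tm_W := work; tm_q0 := (pos 0, mode 0, io, None);
     tm_halt := fun q => q.1.1.2 == mode 8; tm_delta := delta |}.

Definition tape := nat -> tcell.

(* tape cells are numbered from the leftmost visited one, which holds the marker *)
Definition conf (q : tstate) (p : nat) (f : tape) (c : config machine) : Prop :=
  let: (q', l, h, r) := c in
  [/\ q' = q, size l = p & forall j, nth None (rev l ++ h :: r) j = f j].

Definition reaches (T : nat) q p f q' p' f' : Prop :=
  forall c, conf q p f c -> exists2 t, t <= T & conf q' p' f' (tm_run t c).

Definition fupd (f : tape) (p : nat) (w : tcell) : tape := fun j => if j == p then w else f j.

Definition shift (p : nat) (m : move) : nat :=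
  match m with MoveL => p.-1 | MoveR => p.+1 | Stay => p end.

Lemma reaches_ext T q p f q' p' f' f'' : f' =1 f'' ->
  reaches T q p f q' p' f' -> reaches T q p f q' p' f''.
Proof.
move=> ef h c /h[t tT ht]; exists t => //; move: ht.
by rewrite /conf; case: (tm_run _ _) => [[[? ?] ?] ?] [-> -> e]; split=> // j; rewrite e.
Qed.

Lemma reaches_trans T1 T2 q p f q1 p1 f1 q2 p2 f2 :
  reaches T1 q p f q1 p1 f1 -> reaches T2 q1 p1 f1 q2 p2 f2 ->
  reaches (T1 + T2) q p f q2 p2 f2.
Proof.
move=> h1 h2 c /h1[t1 le1 /h2[t2 le2 h]]; exists (t2 + t1); first by lia.
by rewrite /tm_run iterD.
Qed.

(** A left move from cell 0 would add a cell and renumber the tape, hence the side condition. *)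
Lemma reaches_step q p f q' w m :
  q.1.1.2 != mode 8 -> delta q (f p) = (q', w, m) -> (m = MoveL -> 0 < p) ->
  reaches 1 q p f q' (shift p m) (fupd f p w).
Proof.
move=> hq hd hm [[[q0 l] h] r] [-> sl fE]; exists 1 => //.
have hE : h = f p by rewrite -fE nth_cat size_rev sl ltnn subnn.
have uE j : nth None (rev l ++ w :: r) j = fupd f p w j.
  rewrite /fupd -fE !nth_cat size_rev sl; case: ltngtP => //= [|->]; last by rewrite subnn.
  by rewrite -subn_gt0; case: (j - p).
rewrite /tm_run /= (negbTE hq) hE hd.
case: m hm {hd} => hm /=.
- case: l sl uE hm {fE} => [|x l] /= <- uE hm; first by have := hm erefl.
  by split=> // j; rewrite -uE rev_cons cat_rcons.
- case: r uE {fE} => [|x r] uE; split; rewrite /= ?sl // => j; rewrite -uE rev_cons cat_rcons //.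
  rewrite !nth_cat; case: ifP => // _; case: (j - _) => [|[|k]] //=; by rewrite nth_nil.
- by split.
Qed.

Lemma fupd_id f p : fupd f p (f p) =1 f.
Proof. by move=> j; rewrite /fupd; case: eqP => [->|]. Qed.

(** Each cell takes the carried symbol and hands its own entry to the right, up to the first gap in
    the track. The last clause says that no new marker arises. *)
Lemma push_sweep pc i u p f a : 0 < p -> (forall k, dec (f (p + k)) i = onth u k) ->
  exists f', [/\ reaches (size u).+1 (pc, mode 3, i, Some a) p f
                   (pos pc.+1, mode 6, i, None) (p + size u).-1 f',
    forall j, j < p -> f' j = f j,
    forall j r, r != i -> dec (f' j) r = dec (f j) r,
    forall k, dec (f' (p + k)) i = onth (a :: u) k &
    forall j, p <= j -> f j != marker -> f' j != marker].
Proof.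
elim: u p f a => [|b u IH] p f a p0 fE.
  have f0 := fE 0; rewrite addn0 /= in f0.
  exists (fupd f p (put (f p) i (Some a))); split.
  - by rewrite addn0 -[p.-1]/(shift p MoveL); apply: reaches_step => //=; rewrite f0.
  - by move=> j jp; rewrite /fupd ltn_eqF.
  - by move=> j r ri; rewrite /fupd; case: eqP => [->|//]; rewrite dec_put (negbTE ri).
  - case=> [|k]; rewrite /fupd; first by rewrite addn0 eqxx dec_put eqxx.
    by rewrite -{2}[p]addn0 eqn_add2l /= fE; case: k.
  - by move=> j pj; rewrite /fupd; case: ifP => _ //; rewrite put_marker.
set f1 := fupd f p (put (f p) i (Some a)).
have [//|k|f' [hr lo other here mk]] := IH p.+1 f1 b.
  by rewrite /f1 /fupd gtn_eqF ?ltnS ?leq_addr // addSnnS fE.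
have f0 := fE 0; rewrite addn0 /= in f0.
exists f'; split.
- rewrite /= addnS -addSn; apply: (reaches_trans (T1 := 1)) hr.
  by rewrite -[p.+1]/(shift p MoveR); apply: reaches_step => //=; rewrite f0.
- by move=> j jp; rewrite lo ?/f1 /fupd ?ltn_eqF // ltnW.
- by move=> j r ri; rewrite other // /f1 /fupd; case: eqP => [->|//]; rewrite dec_put (negbTE ri).
- case=> [|k]; last by rewrite addnS -addSn here.
  by rewrite addn0 lo // /f1 /fupd eqxx dec_put eqxx.
- move=> j pj fj; have [->|jp] := eqVneq j p; first by rewrite lo // /f1 /fupd eqxx put_marker.
  by apply: mk; [rewrite ltn_neqAle eq_sym jp | rewrite /f1 /fupd (negbTE jp)].
Qed.

Lemma return_sweep pc i p f : f 0 = marker -> (forall j, f j.+1 != marker) ->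
  reaches p.+1 (pc, mode 6, i, None) p f (pc, mode 2, i, None) 1 f.
Proof.
move=> f0 fS; elim: p => [|p IH].
  apply: reaches_ext (fupd_id f 0) _; rewrite -[X in reaches _ _ _ _ _ X]/(shift 0 MoveR).
  by apply: reaches_step; rewrite //= f0 eqxx.
apply: (reaches_trans (T1 := 1)) IH; apply: reaches_ext (fupd_id f p.+1) _.
rewrite -[X in reaches _ _ _ _ _ X]/(shift p.+1 MoveL).
by apply: reaches_step; rewrite //= (negbTE (fS p)).
Qed.

Lemma pop_right pc i u p f : 0 < p -> (forall k, dec (f (p + k)) i = onth u k) ->
  reaches (size u).+1 (pc, mode 4, i, None) p f (pc, mode 5, i, None) (p + size u).-1 f.
Proof.
elim: u p => [|b u IH] p p0 fE; have f0 := fE 0; rewrite addn0 /= in f0.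
  rewrite addn0; apply: reaches_ext (fupd_id f p) _; rewrite -[p.-1]/(shift p MoveL).
  by apply: reaches_step => //=; rewrite f0.
rewrite /= addnS -addSn; apply: (reaches_trans (T1 := 1)) (IH p.+1 _ _) => //; last first.
  by move=> k; rewrite addSnnS fE.
apply: reaches_ext (fupd_id f p) _; rewrite -[p.+1]/(shift p MoveR).
by apply: reaches_step => //=; rewrite f0.
Qed.

(** On the way left, [c] is the entry lifted from the right neighbour, so the track moves one cell
    towards the marker. At the marker the carried symbol is the old top, and it is dropped. *)
Lemma pop_left pc i p f c : f 0 = marker -> (forall j, f j.+1 != marker) ->
  exists f', [/\ reaches p.+1 (pc, mode 5, i, c) p f (pos pc.+1, mode 2, i, None) 1 f',
    forall j, p < j -> f' j = f j,
    f' 0 = marker /\ (forall j, f' j.+1 != marker),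
    forall j r, r != i -> dec (f' j) r = dec (f j) r &
    forall j, 0 < j -> j <= p -> dec (f' j) i = if j == p then c else dec (f j.+1) i].
Proof.
elim: p f c => [|p IH] f c f0 fS.
  exists f; split=> // [|j j0]; last by rewrite leqNgt j0.
  apply: reaches_ext (fupd_id f 0) _; rewrite -[X in reaches _ _ _ _ _ X]/(shift 0 MoveR).
  by apply: reaches_step; rewrite //= f0 eqxx.
set f1 := fupd f p.+1 (put (f p.+1) i c).
have [||f' [hr hi mk other here]] := IH f1 (dec (f p.+1) i).
- by rewrite /f1 /fupd.
- by move=> j; rewrite /f1 /fupd; case: ifP => _ //; rewrite put_marker.
exists f'; split=> //.
- apply: (reaches_trans (T1 := 1)) hr.
  rewrite -[X in reaches _ _ _ _ _ X]/(shift p.+1 MoveL).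
  by apply: reaches_step; rewrite //= (negbTE (fS p)).
- by move=> j pj; rewrite hi 1?ltnW // /f1 /fupd gtn_eqF.
- by move=> j r ri; rewrite other // /f1 /fupd; case: eqP => [->|//]; rewrite dec_put (negbTE ri).
- move=> j j0; rewrite leq_eqVlt; case: eqP => [->|jp] /=.
    by rewrite hi // /f1 /fupd eqxx dec_put eqxx.
  rewrite ltnS => lejp; rewrite here //; case: eqP => [->//|ne].
  by rewrite /f1 /fupd ltn_eqF //; lia.
Qed.

Definition rep (s : store) (f : tape) : Prop :=
  [/\ f 0 = marker, forall j, f j.+1 != marker & forall r j, dec (f j.+1) r = onth (s r) j].

Definition fetches (c : nat * store) (k : config machine) : Prop :=
  exists i f, conf (pos c.1, mode 2, i, None) 1 f k /\ rep c.2 f.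

Lemma onth0_ohead (T : Type) (s : seq T) : onth s 0 = ohead s.
Proof. by case: s. Qed.

Lemma sim_istep c k B : (forall r, size (c.2 r) <= B) -> fetches c k ->
  exists2 t, t <= 2 * B + 6 & fetches (istep code c) (tm_run t k).
Proof.
case: c => pc s /= hB [i [f [hk [f0 fS fE]]]] /=.
case ex : (onth code pc) => [ins|]; last by exists 0 => //; exists i, f.
have pcn : pc < n by rewrite -onthTE ex.
have pcE : pos pc = pc :> nat by rewrite posE; lia.
have stay q' : delta (pos pc, mode 2, i, None) (f 1) = (q', f 1, Stay) ->
    reaches 1 (pos pc, mode 2, i, None) 1 f q' 1 f.
  move=> hd; apply: reaches_ext (fupd_id f 1) _; rewrite -[X in reaches _ _ _ _ _ X]/(shift 1 Stay).
  by apply: reaches_step hd _.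
case: ins ex => [j a|j|j P d|d] ex.
- have [//|m|f' [hr lo other here mk]] := @push_sweep (pos pc) j (s j) 1 f a; first exact: fE.
  have f'0 : f' 0 = marker by rewrite lo.
  have f'S m : f' m.+1 != marker by rewrite mk ?fS.
  have := reaches_trans (stay _ _) (reaches_trans hr (return_sweep f'0 f'S)).
  rewrite /= pcE ex => /(_ erefl) h; have [t tT ht] := h _ hk; exists t.
    by apply: leq_trans tT _; have := hB j; lia.
  exists j, f'; split=> //; split=> // r m; rewrite /upd /=.
  by case: (r =P j) => [->|/eqP rj]; [exact: (here m) | rewrite other].
- have h1 := @pop_right (pos pc) j (s j) 1 f isT (fE j).
  have [f' [hr hi [f'0 f'S] other here]] := @pop_left (pos pc) j (size (s j)) f None f0 fS.
  have := reaches_trans (stay _ _) (reaches_trans h1 hr).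
  rewrite /= pcE ex => /(_ erefl) h; have [t tT ht] := h _ hk; exists t.
    by apply: leq_trans tT _; have := hB j; lia.
  exists j, f'; split=> //; split=> // r m; rewrite /upd /=.
  case: (r =P j) => [->|/eqP rj]; last by rewrite other.
  have -> : onth (behead (s j)) m = onth (s j) m.+1 by case: (s j) => //=; case: m.
  have [lem|ltm] := leqP m.+1 (size (s j)); last first.
    by rewrite hi // fE [RHS]onth_default 1?ltnW // onth_default.
  by rewrite here //; case: eqP => [->|_]; [rewrite onth_default | rewrite fE].
- have := stay _ _ ; rewrite /= pcE ex => /(_ _ erefl) h; have [t tT ht] := h _ hk.
  exists t; first by lia.
  by exists i, f; rewrite /= -onth0_ohead -fE.
- have := stay _ _ ; rewrite /= pcE ex => /(_ _ erefl) h; have [t tT ht] := h _ hk.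
  exists t; first by lia.
  by exists i, f.
Qed.

Lemma sim_iter m c k B : (forall r, size (c.2 r) <= B) -> fetches c k ->
  exists2 t, t <= m * (2 * (B + m) + 6) & fetches (iter m (istep code) c) (tm_run t k).
Proof.
move=> hB hk.
(* All stacks stay below [B + m] throughout, so each of the [m] instructions has the same time
   bound. *)
suff H m' : m' <= m -> exists2 t, t <= m' * (2 * (B + m) + 6) &
    fetches (iter m' (istep code) c) (tm_run t k) by exact: H.
elim: m' => [|m' IH] le; first by exists 0.
have [t tT ht] := IH (ltnW le).
have hB' r : size ((iter m' (istep code) c).2 r) <= B + m.
  by apply: leq_trans (size_istep code m' hB r) _; rewrite leq_add2l ltnW.
have [t' tT' ht'] := sim_istep hB' ht.
exists (t' + t); last by rewrite /tm_run iterD.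
exact: leq_add tT' tT.
Qed.

(** [tm_output] sees raw symbols only: it suffices to turn the entries of [io] into raw symbols, and
    the remaining columns are ignored. *)
Lemma output_sweep pc i u p f : 0 < p -> (forall k, dec (f (p + k)) io = onth u k) ->
  exists f', [/\ reaches (size u).+1 (pc, mode 7, i, None) p f
                   (pc, mode 8, i, None) (p + size u) f',
    forall j, j < p -> f' j = f j &
    forall k, f' (p + k) = if onth u k is Some a then Some (inl a) else f (p + k)].
Proof.
elim: u p f => [|b u IH] p f p0 fE; have f0 := fE 0; rewrite addn0 /= in f0.
  exists f; split=> //; last by case.
  rewrite addn0; apply: reaches_ext (fupd_id f p) _; rewrite -[X in reaches _ _ _ _ _ X]/(shift p Stay).
  by apply: reaches_step => //=; rewrite f0.
set f1 := fupd f p (Some (inl b)).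
have [//|k|f' [hr lo hi]] := IH p.+1 f1.
  by rewrite /f1 /fupd gtn_eqF ?ltnS ?leq_addr // addSnnS fE.
exists f'; split.
- rewrite /= addnS -addSn; apply: (reaches_trans (T1 := 1)) hr.
  by rewrite -[X in reaches _ _ _ _ _ X]/(shift p MoveR); apply: reaches_step => //=; rewrite f0.
- by move=> j jp; rewrite lo ?/f1 /fupd ?ltn_eqF // ltnW.
- case=> [|k]; first by rewrite addn0 lo // /f1 /fupd eqxx.
  by rewrite addnS -addSn hi /=; case: onth => //; rewrite /f1 /fupd gtn_eqF // ltnS leq_addr.
Qed.

Lemma pmap_onth (T U : Type) (g : T -> option U) x0 zs o : g x0 = None ->
  (forall j, g (nth x0 zs j) = onth o j) -> pmap g zs = o.
Proof.
move=> g0; elim: zs o => [|z zs IH] [|a o] h //=.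
- by have := h 0; rewrite /= g0.
- by have /= -> := h 0; apply: IH => j; have := h j.+1; case: (j).
- by have /= -> := h 0; rewrite /= (IH o) // => j; have := h j.+1.
Qed.

Lemma sim_output c k : n <= c.1 -> fetches c k ->
  exists2 t, t <= size (c.2 io) + 2 &
    tm_halted (tm_run t k) /\ tm_output (tm_run t k) = c.2 io.
Proof.
case: c => pc s /= le [i [f [hk [f0 fS fE]]]].
have pcE : pos pc = n :> nat by rewrite posE; lia.
have [f' [hr lo hi]] := @output_sweep (pos pc) i (s io) 1 f isT (fE io).
have h1 : reaches 1 (pos pc, mode 2, i, None) 1 f (pos pc, mode 7, i, None) 1 f.
  apply: reaches_ext (fupd_id f 1) _; rewrite -[X in reaches _ _ _ _ _ X]/(shift 1 Stay).
  by apply: reaches_step => //=; rewrite pcE onth_default.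
have [t tT ht] := reaches_trans h1 hr hk; exists t; first by lia.
move: ht; rewrite /conf /tm_halted /tm_output; case: (tm_run _ _) => [[[q l] h] r] [-> _ e].
split=> //.
case: (rev l ++ h :: r) e => [|z zs] e; first by have := e 0; rewrite /= lo ?f0.
have /= ez := e 0; rewrite ez lo // f0 /=.
apply: (@pmap_onth _ _ _ None) => // j; have /= -> := e j.+1; rewrite -add1n hi.
rewrite -fE add1n; case: (f j.+1) => [[a|[v|]]|] //=; first by rewrite eqxx.
by case: (v io).
Qed.

Theorem machine_correct inp s' m : 
  iter m (istep code) (0, upd (fun=> [::]) io inp) = (n, s') ->
  exists2 t, t <= m * (2 * (size inp + m) + 6) + size inp + m + 4 &
    tm_halted (tm_run t (tm_init machine inp)) /\
    tm_output (tm_run t (tm_init machine inp)) = s' io.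
Proof.
move=> hrun.
(* The first two steps of the machine write the marker into the blank cell left of the input. *)
pose f : tape := fun j => if j is j'.+1 then nth None (map (fun y => Some (inl y)) inp) j' else marker.
have h0 : fetches (0, upd (fun=> [::]) io inp) (tm_run 2 (tm_init machine inp)).
  exists io, f; split.
    by case: inp {hrun} @f => [|x t] f; split=> // -[|[|j]] //=; rewrite nth_nil.
  split=> // [j|r j]; rewrite /= /upd.
    by case: (ltnP j (size inp)) => h; [rewrite (nth_map S0) | rewrite nth_default ?size_map].
  case: (ltnP j (size inp)) => h; last first.
    rewrite nth_default ?size_map //=; case: eqP => // _; by rewrite onth_default.
  rewrite (nth_map S0) //=; case: eqP => _; last by rewrite onth0n.
  by rewrite onthE (nth_map S0).
have sz r : size (upd (fun=> [::]) io inp r) <= size inp by rewrite /upd; case: eqP.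
have [t1 le1 h1] := sim_iter m (c := (_, _)) sz h0.
rewrite hrun in h1; have [t2 le2 h2] := sim_output (leqnn n : n <= (n, s').1) h1.
(* The summand 4 of the bound: two steps for the marker, two to enter and leave the output mode. The
   output has length at most [size inp + m]. *)
exists (t2 + (t1 + 2)); last by rewrite /tm_run !iterD.
have := @size_istep code m (0, upd (fun=> [::]) io inp) _ sz io.
by rewrite hrun /= in le2 *; lia.
Qed.

End Machine.
End StackMachine.

(** * Structured stack programs *)

Section Programs.
Variable R : finType.
Implicit Types (s : store R) (i j k : R) (p q : seq (instr R)) (a : sym) (P : option sym -> bool).

Local Arguments onth : simpl never.

(** Quantifying over the surrounding code lets specifications compose when programs are
    concatenated. *)
Definition steps p s s' (T : nat) : Prop := forall pre post,
  exists2 t, t <= T & iter t (istep (pre ++ p ++ post)) (size pre, s) = (size pre + size p, s').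

Lemma steps_le p s s' T T' : T <= T' -> steps p s s' T -> steps p s s' T'.
Proof. by move=> le h pre post; have [t tT ht] := h pre post; exists t; first exact: leq_trans le. Qed.

Lemma steps_nil s : steps [::] s s 0.
Proof. by move=> pre post; exists 0; rewrite ?addn0. Qed.

Lemma steps_cat p q s1 s2 s3 T1 T2 : steps p s1 s2 T1 -> steps q s2 s3 T2 -> steps (p ++ q) s1 s3 (T1 + T2).
Proof.
move=> hp hq pre post.
have [t1 le1 h1] := hp pre (q ++ post); have [t2 le2 h2] := hq (pre ++ p) post.
exists (t2 + t1); first by lia.
by rewrite iterD -catA h1 -size_cat catA h2 !size_cat addnA.
Qed.

Lemma onth_mid (T : Type) (s1 s2 : seq T) x : onth (s1 ++ x :: s2) (size s1) = Some x.
Proof. by rewrite onth_cat ltnn subnn. Qed.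

Lemma steps_push i a s : steps [:: Push i a] s (upd s i (a :: s i)) 1.
Proof. by move=> pre post; exists 1 => //=; rewrite onth_mid addn1. Qed.

Lemma steps_pop i s : steps [:: Pop i] s (upd s i (behead (s i))) 1.
Proof. by move=> pre post; exists 1 => //=; rewrite onth_mid addn1. Qed.

(** [Unless i pred0] always jumps and serves as the unconditional forward jump over [q]. *)
Definition cond i P p q : seq (instr R) :=
  Unless i P (size p).+1 :: p ++ Unless i pred0 (size q) :: q.

Lemma steps_cond i P p q s s' T :
  steps (if P (ohead (s i)) then p else q) s s' T -> steps (cond i P p q) s s' (T + 2).
Proof.
have first_step pre post : istep (pre ++ cond i P p q ++ post) (size pre, s) =
    (if P (ohead (s i)) then (size pre).+1 else (size pre).+1 + (size p).+1, s).
  by rewrite /istep onth_mid.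
case: ifP => Ps h pre post.
  have [t tT ht] := h (rcons pre (Unless i P (size p).+1)) (Unless i pred0 (size q) :: q ++ post).
  exists (1 + t).+1; first by lia.
  rewrite iterSr first_step Ps iterD.
  rewrite size_rcons cat_rcons in ht; rewrite /cond /= -catA /= ht /=.
  have := onth_mid (pre ++ Unless i P (size p).+1 :: p) (q ++ post) (Unless i pred0 (size q)).
  rewrite -catA /= size_cat /= !addnS !addSn => ->.
  by rewrite size_cat /=; congr (_, _); lia.
have [t tT ht] := h (pre ++ Unless i P (size p).+1 :: p ++ [:: Unless i pred0 (size q)]) post.
exists t.+1; first by lia.
rewrite iterSr first_step Ps.
move: ht; rewrite /cond -!catA /= -!catA !size_cat /= size_cat /= addn1.
rewrite addnS -addSn => ->; congr (_, _); lia.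
Qed.

Definition while_ i P p : seq (instr R) := Unless i P (size p).+1 :: p ++ [:: Back R (size p).+1].

Lemma steps_wh0 i P p s : ~~ P (ohead (s i)) -> steps (while_ i P p) s s 1.
Proof.
move=> Ps pre post; exists 1 => //=; rewrite onth_mid (negbTE Ps) size_cat /=.
by congr (_, _); lia.
Qed.

Lemma steps_whS i P p s s1 s2 T1 T2 : P (ohead (s i)) -> steps p s s1 T1 ->
  steps (while_ i P p) s1 s2 T2 -> steps (while_ i P p) s s2 (T1 + T2 + 2).
Proof.
move=> Ps hp hw pre post.
have [t1 le1 h1] := hp (rcons pre (Unless i P (size p).+1)) (Back R (size p).+1 :: post).
have [t2 le2 h2] := hw pre post.
exists (t2 + 1 + t1 + 1); first by lia.
rewrite !iterD /= onth_mid Ps.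
rewrite size_rcons cat_rcons in h1; rewrite -catA /= h1.
have := onth_mid (pre ++ Unless i P (size p).+1 :: p) post (Back R (size p).+1).
rewrite -catA /= size_cat /= !addnS !addSn => ->.
rewrite (_ : _ - _ = size pre); last by lia.
by rewrite -addnS; rewrite /= -catA in h2.
Qed.

Lemma steps_start p s s' T : steps p s s' T -> exists2 t, t <= T & iter t (istep p) (0, s) = (size p, s').
Proof. by move=> /(_ [::] [::]); rewrite /= cats0. Qed.

Definition top_is a (o : option sym) : bool := o == Some a.
Definition top_isnt a (o : option sym) : bool := o != Some a.

(** An instruction cannot pass on the symbol it tests, so the code holds one copy of [f] per symbol.
    The four nested tests cost 2 steps each. *)
Definition onsym i (f : sym -> seq (instr R)) : seq (instr R) :=
  cond i (top_is S0) (f S0) (cond i (top_is S1) (f S1) (cond i (top_is SComma) (f SComma)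
    (cond i (top_is SSemi) (f SSemi) (f SBar)))).

Lemma steps_onsym i f a x s s' T : s i = a :: x -> steps (f a) s s' T -> steps (onsym i f) s s' (T + 8).
Proof.
move=> si h.
have h2 : steps (f a) s s' (T + 2) by apply: steps_le h; lia.
have h4 : steps (f a) s s' (T + 4) by apply: steps_le h; lia.
have h6 : steps (f a) s s' (T + 6) by apply: steps_le h; lia.
have -> : T + 8 = T + 6 + 2 by lia.
apply: steps_cond; rewrite si /top_is /=; case: ifP => [/eqP[<-] //|n0].
have -> : T + 6 = T + 4 + 2 by lia.
apply: steps_cond; rewrite si /top_is /=; case: ifP => [/eqP[<-] //|n1].
have -> : T + 4 = T + 2 + 2 by lia.
apply: steps_cond; rewrite si /top_is /=; case: ifP => [/eqP[<-] //|n2].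
apply: steps_cond; rewrite si /top_is /=; case: ifP => [/eqP[<-] //|n3].
by move: h n0 n1 n2 n3 {h2 h4 h6 si}; case: a.
Qed.

End Programs.

(** * Moving symbols between stacks *)

Ltac upd_neq := rewrite ?eqxx; repeat match goal with
  | H : is_true (?a != ?b) |- context [?a == ?b] => rewrite (negbTE H)
  | H : is_true (?a != ?b) |- context [?b == ?a] => rewrite [b == a]eq_sym (negbTE H)
  end.

Ltac upd_cases r := lazymatch goal with
  | |- context [r == ?b] =>
      let e := fresh "e" in case: (r =P b) => [e|_];
      [rewrite ?e; upd_neq; try congruence | upd_cases r]
  | _ => try congruence
  end.

Ltac upd_eq := let r := fresh "r" in
  apply: functional_extensionality => r; rewrite /upd; upd_neq; upd_cases r.

Section Macros.
Variable R : finType.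
Implicit Types (s : store R) (i j k : R) (p q : seq (instr R)) (a : sym) (P : option sym -> bool).
Implicit Types (w x y : seq sym).

Lemma upd_same s i v : upd s i v i = v.
Proof. by rewrite /upd eqxx. Qed.

Lemma upd_other s i j v : j != i -> upd s i v j = s j.
Proof. by rewrite /upd => /negbTE->. Qed.

Definition mv i j := onsym i (fun a => [:: Pop i; Push j a]).
Definition mv2 i j k := onsym i (fun a => [:: Pop i; Push j a; Push k a]).

Lemma steps_mv i j s a x : i != j -> s i = a :: x ->
  steps (mv i j) s (upd (upd s i x) j (a :: s j)) 10.
Proof.
move=> ij si; apply: (steps_onsym (T := 2) si).
apply: (steps_cat (T1 := 1) (p := [:: _])); first exact: steps_pop.
have -> : upd (upd s i x) j (a :: s j) =
  upd (upd s i (behead (s i))) j (a :: upd s i (behead (s i)) j) by rewrite si; upd_eq.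
exact: steps_push.
Qed.

Lemma steps_mv2 i j k s a x : i != j -> i != k -> j != k -> s i = a :: x ->
  steps (mv2 i j k) s (upd (upd (upd s i x) j (a :: s j)) k (a :: s k)) 11.
Proof.
move=> ij ik jk si; apply: (steps_onsym (T := 3) si).
apply: (steps_cat (T1 := 1) (p := [:: _])); first exact: steps_pop.
apply: (steps_cat (T1 := 1) (p := [:: _])); first exact: steps_push.
set s1 := upd _ j _; have -> : upd (upd (upd s i x) j (a :: s j)) k (a :: s k) = upd s1 k (a :: s1 k).
  by rewrite /s1 si; upd_eq.
exact: steps_push.
Qed.

Definition stops P w y : bool := all (fun a => P (Some a)) w && ~~ P (ohead y).

Lemma steps_mv_while i j P s w y : i != j -> stops P w y -> s i = w ++ y ->
  steps (while_ i P (mv i j)) s (upd (upd s i y) j (rev w ++ s j)) (12 * size w + 1).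
Proof.
move=> ij /andP[Pw Py]; elim: w s Pw => [|a w IH] s /=.
  move=> _ si; have -> : upd (upd s i y) j (s j) = s by rewrite -si; upd_eq.
  by apply: steps_wh0; rewrite si.
move=> /andP[Pa Pw] si; apply: (@steps_le _ _ _ _ (10 + (12 * size w + 1) + 2)); first by lia.
apply: (steps_whS _ (steps_mv ij si)); first by rewrite si.
set s1 := upd (upd s i (w ++ y)) j (a :: s j); have -> : upd (upd s i y) j (rev (a :: w) ++ s j) =
  upd (upd s1 i y) j (rev w ++ s1 j).
  by rewrite rev_cons cat_rcons /s1; upd_eq.
by apply: IH => //; rewrite /s1 upd_other // upd_same.
Qed.

Lemma steps_mv2_while i j k P s w y : i != j -> i != k -> j != k -> stops P w y -> s i = w ++ y ->
  steps (while_ i P (mv2 i j k)) s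
    (upd (upd (upd s i y) j (rev w ++ s j)) k (rev w ++ s k)) (13 * size w + 1).
Proof.
move=> ij ik jk /andP[Pw Py]; elim: w s Pw => [|a w IH] s /=.
  move=> _ si; have -> : upd (upd (upd s i y) j (s j)) k (s k) = s by rewrite -si; upd_eq.
  by apply: steps_wh0; rewrite si.
move=> /andP[Pa Pw] si; apply: (@steps_le _ _ _ _ (11 + (13 * size w + 1) + 2)); first by lia.
apply: (steps_whS _ (steps_mv2 ij ik jk si)); first by rewrite si.
set s1 := upd (upd (upd s i (w ++ y)) j (a :: s j)) k (a :: s k).
have -> : upd (upd (upd s i y) j (rev (a :: w) ++ s j)) k (rev (a :: w) ++ s k) =
  upd (upd (upd s1 i y) j (rev w ++ s1 j)) k (rev w ++ s1 k).
  by rewrite rev_cons !cat_rcons /s1; upd_eq.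
by apply: IH => //; rewrite /s1 upd_other // upd_other // upd_same.
Qed.

Lemma steps_pop_while i P s w y : stops P w y -> s i = w ++ y ->
  steps (while_ i P [:: Pop i]) s (upd s i y) (3 * size w + 1).
Proof.
move=> /andP[Pw Py]; elim: w s Pw => [|a w IH] s /=.
  move=> _ si; have -> : upd s i y = s by rewrite -si; upd_eq.
  by apply: steps_wh0; rewrite si.
move=> /andP[Pa Pw] si; apply: (@steps_le _ _ _ _ (1 + (3 * size w + 1) + 2)); first by lia.
apply: (steps_whS _ (steps_pop i s)); first by rewrite si.
have -> : upd s i y = upd (upd s i (behead (s i))) i y by upd_eq.
by apply: IH => //; rewrite upd_same si.
Qed.

Lemma stops_some w : stops isSome w [::].
Proof. by rewrite /stops andbT; elim: w. Qed.

Definition mvall i j := while_ i isSome (mv i j).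
Definition clear i := while_ i isSome [:: Pop i].

Lemma steps_mvall i j s : i != j ->
  steps (mvall i j) s (upd (upd s i [::]) j (rev (s i) ++ s j)) (12 * size (s i) + 1).
Proof. by move=> ij; apply: steps_mv_while; rewrite ?cats0 ?stops_some. Qed.

Lemma steps_clear i s : steps (clear i) s (upd s i [::]) (3 * size (s i) + 1).
Proof. by apply: steps_pop_while; rewrite ?cats0 ?stops_some. Qed.

End Macros.

(** * Properties of the encoding *)

Lemma bits_inj : injective bits.
Proof.
have val f n : n <= f -> foldr (fun (b : bool) m => b + m.*2) 0 (bits_aux f n) = n.
  elim: f n => [|f IH] n; first by rewrite leqn0 => /eqP->.
  move=> nf /=; case: eqP => [->//|/eqP n0] /=; rewrite IH ?odd_double_half //.
  by have := odd_double_half n; lia.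
by move=> m n e; rewrite -(val m m) // -(val n n) // -/(bits m) -/(bits n) e.
Qed.

Definition no_mark (w : seq sym) : bool := all (fun a => (a == S0) || (a == S1)) w.

Lemma no_mark_enc_nat n : no_mark (enc_nat n).
Proof. by rewrite /no_mark /enc_nat all_map; apply/allP; case. Qed.

Lemma enc_nat_inj : injective enc_nat.
Proof. by move=> m n /(inj_map (f := fun b : bool => _)) h; apply: bits_inj; apply: h => -[] []. Qed.

Lemma semi_notin_enc_str s : SSemi \notin enc_str s.
Proof.
apply/negP => /flattenP[w /mapP[c _ ->]]; rewrite mem_cat inE orbF.
by move/(allP (no_mark_enc_nat c)).
Qed.

Lemma enc_list_cons s X : enc_list (s :: X) = enc_str s ++ SSemi :: enc_list X.
Proof. by rewrite /enc_list /= -catA. Qed.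

Lemma enc_list_cat X Y : enc_list (X ++ Y) = enc_list X ++ enc_list Y.
Proof. by rewrite /enc_list map_cat flatten_cat. Qed.

(** All time bounds are stated in the size of the encoding, which is the same for every candidate
    order. *)
Lemma size_enc_list_perm X Y : perm_eq X Y -> size (enc_list X) = size (enc_list Y).
Proof.
by move=> p; rewrite /enc_list !size_flatten /shape; apply/perm_sumn/perm_map/perm_map.
Qed.

Ltac upd_at := repeat first [rewrite upd_same | rewrite upd_other; [|by []]].

Section TokenMacros.
Variable R : finType.
Implicit Types (s : store R) (i j k : R) (p q : seq (instr R)) (a : sym) (P : option sym -> bool).
Implicit Types (w x y : seq sym).

Lemma stops_semi w y : SSemi \notin w -> stops (top_isnt SSemi) w (SSemi :: y).
Proof.
move=> h; rewrite /stops /top_isnt /= andbT; apply/allP => a aw /=.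
by apply: contraNneq h => -[<-].
Qed.

(** The way through the scratch stack [t] reverses the token twice, so both copies read correctly;
    the terminator goes below the copy and must be pushed first. *)
Definition copytok t i j : seq (instr R) :=
  while_ i (top_isnt SSemi) (mv i t) ++ [:: Push j SSemi] ++ while_ t isSome (mv2 t i j).

Lemma steps_copytok t i j s w y : uniq [:: t; i; j] -> SSemi \notin w ->
  s i = w ++ SSemi :: y -> s t = [::] ->
  steps (copytok t i j) s (upd s j (w ++ SSemi :: s j)) (25 * size w + 3).
Proof.
rewrite /= !inE !negb_or => /and3P[/andP[ti tj] ij _] hw si st.
have it : i != t by rewrite eq_sym.
apply: (@steps_le _ _ _ _ ((12 * size w + 1) + (1 + (13 * size (rev w) + 1)))).
  by rewrite size_rev; lia.
apply: steps_cat (steps_mv_while it (stops_semi y hw) si) _.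
apply: steps_cat (steps_push _ _ _) _.
set s1 := upd _ j _; have s1t : s1 t = rev w ++ [::].
  by rewrite /s1 upd_other // upd_same st.
have -> : upd s j (w ++ SSemi :: s j) =
   upd (upd (upd s1 t [::]) i (rev (rev w) ++ s1 i)) j (rev (rev w) ++ s1 j).
  by rewrite revK /s1; upd_eq.
exact: steps_mv2_while (stops_some _) s1t.
Qed.

Definition droptok i : seq (instr R) := while_ i (top_isnt SSemi) [:: Pop i] ++ [:: Pop i].

Lemma steps_droptok i s w y : SSemi \notin w -> s i = w ++ SSemi :: y ->
  steps (droptok i) s (upd s i y) (3 * size w + 2).
Proof.
move=> hw si; apply: (@steps_le _ _ _ _ ((3 * size w + 1) + 1)); first by clear; lia.
apply: steps_cat (steps_pop_while (stops_semi y hw) si) _.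
set s1 := upd _ _ _; have -> : upd s i y = upd s1 i (behead (s1 i)) by rewrite /s1; upd_eq.
exact: steps_pop.
Qed.

Definition mvtok t i j := copytok t i j ++ droptok i.

Lemma steps_mvtok t i j s w y : uniq [:: t; i; j] -> SSemi \notin w ->
  s i = w ++ SSemi :: y -> s t = [::] ->
  steps (mvtok t i j) s (upd (upd s i y) j (w ++ SSemi :: s j)) (28 * size w + 5).
Proof.
move=> u hw si st; apply: (@steps_le _ _ _ _ ((25 * size w + 3) + (3 * size w + 2))); first by clear; lia.
apply: steps_cat (steps_copytok u hw si st) _.
move: u; rewrite /= !inE !negb_or => /and3P[/andP[ti tj] ij _].
have -> : upd (upd s i y) j (w ++ SSemi :: s j) = upd (upd s j (w ++ SSemi :: s j)) i y by upd_eq.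
by apply: steps_droptok hw _; rewrite upd_other.
Qed.

(** Reverses the order of the tokens but keeps each token intact, unlike [mvall]. *)
Definition mvtoks t i j := while_ i isSome (mvtok t i j).

Lemma steps_mvtoks t i j s X Y : uniq [:: t; i; j] ->
  s i = enc_list X -> s j = enc_list Y -> s t = [::] ->
  steps (mvtoks t i j) s (upd (upd s i [::]) j (enc_list (rev X ++ Y)))
    (35 * size (enc_list X) + 1).
Proof.
move=> u; elim: X Y s => [|x X IH] Y s si sj st.
  have -> : upd (upd s i [::]) j (enc_list (rev [::] ++ Y)) = s.
    by rewrite /= -sj -[[::]]/(enc_list [::]) -si; upd_eq.
  by apply: steps_wh0; rewrite si.
rewrite enc_list_cons in si; have h := steps_mvtok u (semi_notin_enc_str x) si st.
move: (u); rewrite /= !inE !negb_or => /and3P[/andP[ti tj] ij _].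
set s1 := upd _ j _ in h.
have -> : upd (upd s i [::]) j (enc_list (rev (x :: X) ++ Y)) =
    upd (upd s1 i [::]) j (enc_list (rev X ++ x :: Y)).
  by rewrite rev_cons cat_rcons /s1; upd_eq.
rewrite enc_list_cons size_cat /=.
apply: (steps_le _ (steps_whS _ h (IH (x :: Y) s1 _ _ _))); first by clear; lia.
- by rewrite si; case: (enc_str x).
- by rewrite /s1 upd_other // upd_same.
- by rewrite /s1 upd_same enc_list_cons sj.
- by rewrite /s1 upd_other // upd_other.
Qed.

Definition mvtoks2 t i j k := while_ i isSome (copytok t i j ++ mvtok t i k).

Lemma steps_mvtoks2 t i j k s X Y Z : uniq [:: t; i; j; k] ->
  s i = enc_list X -> s j = enc_list Y -> s k = enc_list Z -> s t = [::] ->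
  steps (mvtoks2 t i j k) s
    (upd (upd (upd s i [::]) j (enc_list (rev X ++ Y))) k (enc_list (rev X ++ Z)))
    (60 * size (enc_list X) + 1).
Proof.
move=> u; move: (u); rewrite /= !inE !negb_or => /and4P[/and3P[ti tj tk] /andP[ij ik] jk _].
have u1 : uniq [:: t; i; j] by rewrite /= !inE negb_or ti tj ij.
have u2 : uniq [:: t; i; k] by rewrite /= !inE negb_or ti tk ik.
elim: X Y Z s => [|x X IH] Y Z s si sj sk st.
  have -> : upd (upd (upd s i [::]) j (enc_list (rev [::] ++ Y))) k (enc_list (rev [::] ++ Z)) = s.
    by rewrite /= -sj -sk -[[::]]/(enc_list [::]) -si; upd_eq.
  by apply: steps_wh0; rewrite si.
rewrite enc_list_cons in si.
have h1 := steps_copytok u1 (semi_notin_enc_str x) si st.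
set s1 := upd s j _ in h1.
have s1i : s1 i = enc_str x ++ SSemi :: enc_list X by rewrite /s1 upd_other.
have s1t : s1 t = [::] by rewrite /s1 upd_other.
have h2 := steps_mvtok u2 (semi_notin_enc_str x) s1i s1t.
set s2 := upd _ k _ in h2.
have -> : upd (upd (upd s i [::]) j (enc_list (rev (x :: X) ++ Y))) k (enc_list (rev (x :: X) ++ Z)) =
    upd (upd (upd s2 i [::]) j (enc_list (rev X ++ x :: Y))) k (enc_list (rev X ++ x :: Z)).
  by rewrite rev_cons !cat_rcons /s2 /s1; upd_eq.
rewrite enc_list_cons size_cat /=.
have ki : k != i by rewrite eq_sym.
have kj : k != j by rewrite eq_sym.
apply: (steps_le _ (steps_whS _ (steps_cat h1 h2) (IH (x :: Y) (x :: Z) s2 _ _ _ _))); first by clear; lia.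
- by rewrite si; case: (enc_str x).
- by rewrite /s2 upd_other // upd_same.
- by rewrite /s2 upd_other // upd_other 1?eq_sym // /s1 upd_same enc_list_cons sj.
- by rewrite /s2 upd_same /s1 upd_other // enc_list_cons sk.
- by rewrite /s2 upd_other // upd_other.
Qed.

(** Destructive comparison: a match consumes the top of [p], a mismatch adds a mark to [z]. Marks
    are never removed and a surplus of [p] remains, so from an empty [z] both results are empty
    exactly if [p] and [q] agree. *)
Fixpoint strip (q p z : seq sym) : seq sym * seq sym :=
  if q is a :: q' then
    if ohead p == Some a then strip q' (behead p) z else strip q' p (S0 :: z)
  else (p, z).

Lemma strip_eq (q p z : seq sym) : ((strip q p z).1 == [::]) && ((strip q p z).2 == [::]) = (p == q) && (z == [::]).
Proof.
elim: q p z => [|a q IH] p z //=.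
case: p => [|b p] /=; first by rewrite IH andbF.
by rewrite eqseq_cons (inj_eq Some_inj); case: (b =P a) => _; rewrite IH ?andbF.
Qed.

Lemma size_strip (q p z : seq sym) :
  size (strip q p z).1 <= size p /\ size (strip q p z).2 <= size q + size z.
Proof.
elim: q p z => [|a q IH] p z //=; case: ifP => _.
  by have [h1 h2] := IH (behead p) z; move: h1; rewrite size_behead; lia.
by have [h1 h2] := IH p (S0 :: z); rewrite /= in h2; lia.
Qed.

(* P is the previous character, Q the current one (which becomes the previous one), and c
   counts in unary *)
Definition compare_char (c P Q W Z : R) : seq (instr R) :=
  while_ Q isSome (onsym Q (fun a => [:: Pop Q; Push W a] ++ cond P (top_is a) [:: Pop P] [:: Push Z S0]))
  ++ while_ P isSome [:: Pop P; Push Z S0]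
  ++ cond Z isSome [:: Push c S0] [::]
  ++ clear Z
  ++ mvall W P.

Lemma steps_strip (P Q W Z : R) s (q : seq sym) : uniq [:: P; Q; W; Z] -> s Q = q ->
  steps (while_ Q isSome (onsym Q (fun a => [:: Pop Q; Push W a] ++ cond P (top_is a) [:: Pop P] [:: Push Z S0])))
   s (upd (upd (upd (upd s Q [::]) W (rev q ++ s W)) P (strip q (s P) (s Z)).1)
       Z (strip q (s P) (s Z)).2) (16 * size q + 1).
Proof.
rewrite /= !inE !negb_or => /and4P[/and3P[PQ PW PZ] /andP[QW QZ] WZ _].
have QP : Q != P by rewrite eq_sym.
elim: q s => [|a q IH] s sQ.
  have -> : upd (upd (upd (upd s Q [::]) W (rev [::] ++ s W)) P (strip [::] (s P) (s Z)).1)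
       Z (strip [::] (s P) (s Z)).2 = s by rewrite /= -sQ; upd_eq.
  by apply: steps_wh0; rewrite sQ.
pose s1 := upd (upd s Q q) W (a :: s W).
have h1 : steps [:: Pop Q; Push W a] s s1 2.
  apply: (steps_cat (T1 := 1) (p := [:: _])); first exact: steps_pop.
  have -> : s1 = upd (upd s Q (behead (s Q))) W (a :: upd s Q (behead (s Q)) W).
    by rewrite /s1 sQ; upd_eq.
  exact: steps_push.
have s1P : s1 P = s P by rewrite /s1 !upd_other.
have s1Z : s1 Z = s Z by rewrite /s1 !upd_other // eq_sym.
pose s2 := if ohead (s P) == Some a then upd s1 P (behead (s P)) else upd s1 Z (S0 :: s Z).
have h2 : steps (cond P (top_is a) [:: Pop P] [:: Push Z S0]) s1 s2 3.
  apply: (steps_cond (T := 1)); rewrite s1P /top_is /s2; case: ifP => _.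
    by rewrite -s1P; apply: steps_pop.
  by rewrite -s1Z; apply: steps_push.
pose step := onsym Q (fun a => [:: Pop Q; Push W a] ++ cond P (top_is a) [:: Pop P] [:: Push Z S0]).
have h : steps step s s2 13 by apply: (steps_onsym (T := 5) sQ); apply: steps_cat h1 h2.
have s2Q : s2 Q = q.
  by rewrite /s2; case: ifP => _; rewrite /s1; upd_at.
rewrite [size _]/=; apply: (steps_le _ (steps_whS _ h _)); last first.
- have -> : upd (upd (upd (upd s Q [::]) W (rev (a :: q) ++ s W)) P (strip (a :: q) (s P) (s Z)).1)
       Z (strip (a :: q) (s P) (s Z)).2 =
    upd (upd (upd (upd s2 Q [::]) W (rev q ++ s2 W)) P (strip q (s2 P) (s2 Z)).1)
       Z (strip q (s2 P) (s2 Z)).2.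
    by rewrite rev_cons cat_rcons /= {s2Q h h2}/s2; case: ifP => _; rewrite /s1; upd_eq.
  exact: IH.
- by rewrite sQ.
- by lia.
Qed.

(** Turns the surplus of the previous character into marks too, so that one test of [Z] decides. *)
Lemma steps_pop_push (P Z : R) s (p : seq sym) : P != Z -> s P = p ->
  steps (while_ P isSome [:: Pop P; Push Z S0]) s
    (upd (upd s P [::]) Z (nseq (size p) S0 ++ s Z)) (4 * size p + 1).
Proof.
move=> PZ; elim: p s => [|a p IH] s sP.
  have -> : upd (upd s P [::]) Z (nseq (size (Nil sym)) S0 ++ s Z) = s by rewrite /= -sP; upd_eq.
  by apply: steps_wh0; rewrite sP.
pose s1 := upd (upd s P p) Z (S0 :: s Z).
have h1 : steps [:: Pop P; Push Z S0] s s1 2.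
  apply: (steps_cat (T1 := 1) (p := [:: _])); first exact: steps_pop.
  have -> : s1 = upd (upd s P (behead (s P))) Z (S0 :: upd s P (behead (s P)) Z).
    by rewrite /s1 sP; upd_eq.
  exact: steps_push.
have -> : upd (upd s P [::]) Z (nseq (size (a :: p)) S0 ++ s Z) =
    upd (upd s1 P [::]) Z (nseq (size p) S0 ++ s1 Z).
  rewrite -[nseq (size (a :: p)) S0]/(S0 :: nseq (size p) S0).
  rewrite (_ : (_ :: _) ++ _ = nseq (size p) S0 ++ S0 :: s Z); last by elim: (size p) => //= n ->.
  by rewrite /s1; upd_eq.
rewrite [size _]/=; apply: (steps_le _ (steps_whS _ h1 (IH s1 _))).
- by clear; rewrite /=; lia.
- by rewrite sP.
- by rewrite /s1 upd_other // upd_same.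
Qed.

Lemma steps_compare_char (c P Q W Z : R) s (p q : seq sym) : uniq [:: c; P; Q; W; Z] ->
  s P = p -> s Q = q -> s W = [::] -> s Z = [::] ->
  steps (compare_char c P Q W Z) s
    (upd (upd (upd s c (if p == q then s c else S0 :: s c)) P q) Q [::])
    (60 * (size p + size q) + 20).
Proof.
move=> u sP sQ sW sZ; have := u.
rewrite /= !inE !negb_or => /and5P[/and4P[cP cQ cW cZ] /and3P[PQ PW PZ] /andP[QW QZ] WZ _].
have [Pc Qc Wc Zc] : [/\ P != c, Q != c, W != c & Z != c] by split; rewrite eq_sym.
have [QP WP ZP] : [/\ Q != P, W != P & Z != P] by split; rewrite eq_sym.
have [WQ ZQ ZW] : [/\ W != Q, Z != Q & Z != W] by split; rewrite eq_sym.
have u1 : uniq [:: P; Q; W; Z] by case/andP: u.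
have h1 := steps_strip u1 sQ; rewrite sP sZ sW cats0 in h1.
set p' := (strip q p [::]).1 in h1; set z' := (strip q p [::]).2 in h1.
set s1 := upd _ Z _ in h1.
have s1P : s1 P = p' by rewrite /s1 upd_other // upd_same.
have h2 := steps_pop_push PZ s1P; set s2 := upd _ Z _ in h2.
have s2Z : s2 Z = nseq (size p') S0 ++ z' by rewrite /s2 upd_same /s1 upd_same.
pose s3 := if p == q then s2 else upd s2 c (S0 :: s2 c).
have h3 : steps (cond Z isSome [:: Push c S0] [::]) s2 s3 3.
  apply: (steps_cond (T := 1)); rewrite s2Z /s3.
  have := strip_eq q p [::]; rewrite -/p' -/z' eqxx andbT => <-.
  case: (p') => [|? ?] /=; last exact: steps_push.
  by case: (z') => [|? ?] /=; [apply: steps_le (steps_nil _) | exact: steps_push].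
have s3Z : s3 Z = nseq (size p') S0 ++ z'.
  by rewrite /s3; case: ifP => _ //; rewrite upd_other.
have h4 := steps_clear Z s3; set s4 := upd _ Z _ in h4.
have h5 := steps_mvall s4 WP.
have s4W : s4 W = rev q.
  by rewrite /s4 /s3; case: ifP => _; rewrite /s2 /s1; upd_at.
have s4P : s4 P = [::].
  by rewrite /s4 /s3; case: ifP => _; rewrite /s2 /s1; upd_at.
rewrite s4W s4P revK cats0 in h5.
have -> : upd (upd (upd s c (if p == q then s c else S0 :: s c)) P q) Q [::] =
  upd (upd s4 W [::]) P q.
  by rewrite /s4 /s3; case: ifP => _; rewrite /s2 /s1; upd_eq.
have := steps_cat h1 (steps_cat h2 (steps_cat h3 (steps_cat h4 h5))).
have [l1 l2] := size_strip q p [::].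
apply: steps_le; rewrite size_rev s3Z size_cat size_nseq -/p' -/z' in l1 l2 *; rewrite /= in l2.
by clear -l1 l2; lia.
Qed.

End TokenMacros.

(** * Counting phrases *)

(* None stands for an end-of-string mark *)
Definition enc_item (o : option nat) : seq sym :=
  if o is Some c then enc_nat c ++ [:: SComma] else [:: SSemi].

Definition items (X : seq str) : seq (option nat) :=
  flatten (map (fun s => rcons (map Some s) None) X).

Lemma enc_list_items X : enc_list X = flatten (map enc_item (items X)).
Proof.
elim: X => // x X IH; rewrite enc_list_cons IH /items /= map_cat flatten_cat map_rcons flatten_rcons.
by rewrite -catA /= -map_comp.
Qed.

Lemma pmap_items X : pmap id (items X) = flatten X.
Proof.
elim: X => // x X IH; rewrite /items /= pmap_cat -/(items X) IH; congr (_ ++ _).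
by elim: x => //= c x ->.
Qed.

(* moving a character from one stack to another leaves its bits reversed *)
Definition enc_prev (o : option nat) : seq sym :=
  if o is Some c then SComma :: rev (enc_nat c) else [::].

(** The comma separates the character 0, whose bits are empty, from [None]. *)
Lemma enc_prev_inj : injective enc_prev.
Proof. by case=> [x|] [y|] //= [] /(can_inj revK) /enc_nat_inj ->. Qed.

Section Score.
Variable R : finType.
Implicit Types (s : store R) (i j k : R) (p q : seq (instr R)) (a : sym) (P : option sym -> bool).
Implicit Types (w x y : seq sym).

Lemma stops_comma w y : no_mark w -> stops (top_isnt SComma) w (SComma :: y).
Proof.
by move=> /allP h; rewrite /stops andbT; apply/allP => a /h /orP[] /eqP->.
Qed.

(** End-of-string marks are moved without touching [P], so runs are counted across string
    boundaries. [V] keeps the input for later restoration. *)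
Definition scan (i c V P Q W Z : R) : seq (instr R) :=
  while_ i isSome (cond i (top_is SSemi) (mv i V)
    (while_ i (top_isnt SComma) (mv2 i V Q) ++ mv2 i V Q ++ compare_char c P Q W Z)).

Lemma steps_scan (i c V P Q W Z : R) s l o : uniq [:: i; V; c; P; Q; W; Z] ->
  s i = flatten (map enc_item l) -> s P = enc_prev o -> s Q = [::] -> s W = [::] -> s Z = [::] ->
  (* [v] is what remains on [P] after the last character; only the time to clear it matters. *)
  exists2 v, size v <= size (enc_prev o) + size (s i) &
  steps (scan i c V P Q W Z) s
    (upd (upd (upd (upd s i [::]) V (rev (s i) ++ s V)) P v) c (nseq (runs o (pmap id l)) S0 ++ s c))
    (200 * size (s i) + 60 * size (enc_prev o) + 1).
Proof.
move=> u; move: (u); rewrite !cons_uniq !inE !negb_or.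
move=> /and5P[/and5P[iV ic iP iQ /andP[iW iZ]] /and5P[Vc VP VQ VW VZ] /and4P[cP cQ cW cZ]].
move=> /and3P[PQ PW PZ] /and3P[/andP[QW QZ] WZ _].
have u1 : uniq [:: c; P; Q; W; Z] by case/and3P: u.
have [Vi Pi Qi Wi Zi] : [/\ V != i, P != i, Q != i, W != i & Z != i] by split; rewrite eq_sym.
have [PV QV WV ZV] : [/\ P != V, Q != V, W != V & Z != V] by split; rewrite eq_sym.
have [ci cV Pc Qc Wc] : [/\ c != i, c != V, P != c, Q != c & W != c] by split; rewrite eq_sym.
have [Zc QP WP ZP] : [/\ Z != c, Q != P, W != P & Z != P] by split; rewrite eq_sym.
have [WQ ZQ ZW] : [/\ W != Q, Z != Q & Z != W] by split; rewrite eq_sym.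
elim: l o s => [|[n|] l IH] o s si sP sQ sW sZ.
- exists (enc_prev o); first exact: leq_addr.
  rewrite (_ : upd _ _ _ = s); first by apply: steps_le (steps_wh0 _ _); rewrite ?si //; clear; lia.
  by rewrite si -sP /= -[[::]]si; upd_eq.
- rewrite /= -catA /= in si; set rest := flatten _ in si.
  have h1 := steps_mv2_while iV iQ VQ (stops_comma _ (no_mark_enc_nat n)) si.
  set s1 := upd _ Q _ in h1.
  have s1i : s1 i = SComma :: rest by rewrite /s1; upd_at.
  have h2 := steps_mv2 iV iQ VQ s1i; set s2 := upd _ Q _ in h2.
  have s2Q : s2 Q = enc_prev (Some n) by rewrite /s2 /s1 /=; upd_at; rewrite sQ cats0.
  have s2P : s2 P = enc_prev o by rewrite /s2 /s1; upd_at.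
  have s2W : s2 W = [::] by rewrite /s2 /s1; upd_at.
  have s2Z : s2 Z = [::] by rewrite /s2 /s1; upd_at.
  have h3 := steps_compare_char u1 s2P s2Q s2W s2Z.
  rewrite (inj_eq enc_prev_inj) in h3; set s3 := upd _ Q _ in h3.
  have s3i : s3 i = rest by rewrite /s3 /s2; upd_at.
  have [||||v sv hv] := IH (Some n) s3 s3i.
  + by rewrite /s3; upd_at.
  + by rewrite /s3; upd_at.
  + by rewrite /s3; upd_at.
  + by rewrite /s3; upd_at.
  rewrite s3i in sv hv; exists v.
    by apply: leq_trans sv _; rewrite si size_cat /= size_rev; clear; lia.
  have hb : steps (cond i (top_is SSemi) (mv i V)
    (while_ i (top_isnt SComma) (mv2 i V Q) ++ mv2 i V Q ++ compare_char c P Q W Z)) s s3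
     (13 * size (enc_nat n) + 1 + (11 + (60 * (size (enc_prev o) + size (enc_prev (Some n))) + 20)) + 2).
    apply: steps_cond; rewrite si.
    have -> : top_is SSemi (ohead (enc_nat n ++ SComma :: rest)) = false.
      by have := no_mark_enc_nat n; case: (enc_nat n) => [|a w] //= /andP[/orP[]/eqP->].
    exact: steps_cat h1 (steps_cat h2 h3).
  have top : isSome (ohead (s i)) by rewrite si; case: (enc_nat n).
  rewrite (_ : upd _ c _ = upd (upd (upd (upd s3 i [::]) V (rev rest ++ s3 V)) P v) c
     (nseq (runs (Some n) (pmap id l)) S0 ++ s3 c)).
    apply: steps_le (steps_whS top hb hv).
    by rewrite si size_cat /= size_rev; clear; lia.
  have -> : rev (s i) ++ s V = rev rest ++ s3 V.
    by rewrite si /s3 /s2 /s1; upd_at; rewrite rev_cat rev_cons -catA cat_rcons.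
  have -> : nseq (runs o (pmap id (Some n :: l))) S0 ++ s c = nseq (runs (Some n) (pmap id l)) S0 ++ s3 c.
    rewrite /s3 /s2 /s1; upd_at; rewrite /=.
    case: eqP => //= _; by elim: (runs _ _) => //= m ->.
  by rewrite /s3 /s2 /s1; upd_eq.
rewrite /= in si; set rest := flatten _ in si.
have h1 := steps_mv iV si; set s1 := upd _ V _ in h1.
have s1i : s1 i = rest by rewrite /s1; upd_at.
have [||||v sv hv] := IH o s1 s1i.
+ by rewrite /s1; upd_at.
+ by rewrite /s1; upd_at.
+ by rewrite /s1; upd_at.
+ by rewrite /s1; upd_at.
rewrite s1i in sv hv; exists v.
  by apply: leq_trans sv _; rewrite si /=; clear; lia.
have hb : steps (cond i (top_is SSemi) (mv i V)
    (while_ i (top_isnt SComma) (mv2 i V Q) ++ mv2 i V Q ++ compare_char c P Q W Z)) s s1 (10 + 2).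
  by apply: steps_cond; rewrite si.
have top : isSome (ohead (s i)) by rewrite si.
rewrite (_ : upd _ c _ = upd (upd (upd (upd s1 i [::]) V (rev rest ++ s1 V)) P v) c
     (nseq (runs o (pmap id l)) S0 ++ s1 c)).
  apply: steps_le (steps_whS top hb hv).
  by rewrite si /=; clear; lia.
rewrite si rev_cons cat_rcons /=.
by rewrite /s1; upd_eq.
Qed.

Definition score (i c V P Q W Z : R) : seq (instr R) :=
  scan i c V P Q W Z ++ clear P ++ mvall V i.

Lemma steps_score (i c V P Q W Z : R) s X : uniq [:: i; V; c; P; Q; W; Z] ->
  s i = enc_list X -> s V = [::] -> s P = [::] -> s Q = [::] -> s W = [::] -> s Z = [::] ->
  steps (score i c V P Q W Z) s (upd s c (nseq (batch_cost X) S0 ++ s c))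
    (220 * size (enc_list X) + 3).
Proof.
move=> u si sV sP sQ sW sZ.
have si' : s i = flatten (map enc_item (items X)) by rewrite si enc_list_items.
have [v sv hv] := steps_scan (o := None) u si' sP sQ sW sZ.
rewrite pmap_items -size_rle -/(batch_cost X) si sV cats0 /= in sv hv.
move: u; rewrite !cons_uniq !inE !negb_or.
move=> /and5P[/and5P[iV ic iP iQ /andP[iW iZ]] /and5P[Vc VP VQ VW VZ] /and4P[cP cQ cW cZ] _ _].
have [Vi Pc ci] : [/\ V != i, P != c & c != i] by split; rewrite eq_sym.
set s1 := upd _ c _ in hv.
have h2 := steps_clear P s1; set s2 := upd _ P _ in h2.
have h3 := steps_mvall s2 Vi.
have s2V : s2 V = rev (enc_list X) by rewrite /s2 /s1; upd_at.
have s2i : s2 i = [::] by rewrite /s2 /s1; upd_at.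
have s1P : s1 P = v by rewrite /s1; upd_at.
rewrite s2V s2i revK cats0 in h3; rewrite s1P in h2.
have -> : upd s c (nseq (batch_cost X) S0 ++ s c) = upd (upd s2 V [::]) i (enc_list X).
  by rewrite /s2 /s1; upd_eq.
apply: steps_le (steps_cat hv (steps_cat h2 h3)).
by rewrite size_rev; clear -sv; lia.
Qed.

End Score.

(** * Enumerating the decompositions into blocks *)

Lemma size_le_enc_list X : size X <= size (enc_list X).
Proof. by elim: X => // x X IH; rewrite enc_list_cons size_cat /=; lia. Qed.

Lemma size_enc_list_cat X Y : size (enc_list (X ++ Y)) = size (enc_list X) + size (enc_list Y).
Proof. by rewrite enc_list_cat size_cat. Qed.

Lemma size_enc_list_rev X : size (enc_list (rev X)) = size (enc_list X).
Proof. by apply: size_enc_list_perm; rewrite perm_rev. Qed.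

(** Every phrase uses a character, and every character at least its comma. This justifies the length
    of the input as a bound on the rounds. *)
Lemma batch_cost_le X : batch_cost X <= size (enc_list X).
Proof.
have runs_le p s : runs p s <= size s.
  by elim: s p => //= x s IH p; have := IH (Some x); case: (_ != _) => /=; lia.
rewrite /batch_cost size_rle; apply: leq_trans (runs_le _ _) _.
elim: X => // x X IH; rewrite enc_list_cons /= !size_cat /=.
apply: leq_add; last exact: leqW.
by elim: x => //= c x IHx; rewrite /enc_str /= !size_cat /= -/(enc_str x); lia.
Qed.

Section ForCut.
Variable R : finType.
Variables (t x e g : R).
Hypothesis uniq_regs : uniq [:: t; x; e; g].
Implicit Types (X E G L : seq str).

(* body is run once for each way of cutting e in two; the part before the cut is on x, reversed *)
Definition for_cut (body : seq (instr R)) : seq (instr R) :=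
  body ++ while_ e isSome (mvtok t e x ++ body) ++ mvtoks t x e.

(** [n] bounds both the encoded length and the number of tokens: at most [n.+1] runs of the body,
    each with a token move, then the restoration. *)
Definition for_cut_time n T := n.+1 * (T + 28 * n + 20) + 36 * n + 10.

Variable base : store R.
Hypothesis base_t : base t = [::].

Definition cut_store X E G : store R :=
  upd (upd (upd base x (enc_list X)) e (enc_list E)) g (enc_list G).

(** [Q X E m] says that the best cost [m] meets what the cut into [X] and [E] demands. It must
    survive a smaller [m], since later runs may still improve [G]. In nested loops [Q] is the
    guarantee of the inner loop. *)
Lemma steps_for_cut body T L L0 (Q : seq str -> seq str -> nat -> Prop) :
  (forall X E m m', m' <= m -> Q X E m -> Q X E m') ->
  (forall X E G, rev X ++ E = L -> perm_eq G L0 -> exists G',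
     [/\ perm_eq G' L0, batch_cost G' <= batch_cost G, Q X E (batch_cost G') &
         steps body (cut_store X E G) (cut_store X E G') T]) ->
  forall G, perm_eq G L0 -> exists G',
     [/\ perm_eq G' L0, batch_cost G' <= batch_cost G,
         forall X E, rev X ++ E = L -> Q X E (batch_cost G') &
         steps (for_cut body) (cut_store [::] L G) (cut_store [::] L G')
           (for_cut_time (size (enc_list L)) T)].
Proof.
move: (uniq_regs); rewrite /= !inE !negb_or => /and4P[/and3P[tx te tg] /andP[xe xg] eg _].
have [ex gx ge] : [/\ e != x, g != x & g != e] by split; rewrite eq_sym.
move=> Qmono hbody.
have u1 : uniq [:: t; e; x] by rewrite /= !inE negb_or te tx ex.
have u2 : uniq [:: t; x; e] by rewrite /= !inE negb_or te tx xe.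
set n := size (enc_list L).
have loop E : forall X G, rev X ++ E = L -> perm_eq G L0 -> exists G',
    [/\ perm_eq G' L0, batch_cost G' <= batch_cost G,
      forall E1 E2, E = E1 ++ E2 -> E1 != [::] -> Q (rev E1 ++ X) E2 (batch_cost G') &
      steps (while_ e isSome (mvtok t e x ++ body)) (cut_store X E G) (cut_store (rev E ++ X) [::] G')
        (size E * (T + 28 * n + 20) + 1)].
  elim: E => [|y E IH] X G defL pG.
    exists G; split=> //; first by case.
    by apply: steps_wh0; rewrite /cut_store; upd_at.
  have defL' : rev (y :: X) ++ E = L by rewrite rev_cons cat_rcons.
  have [G1 [pG1 le1 Q1 h1]] := hbody _ _ _ defL' pG.
  have [G2 [pG2 le2 Q2 h2]] := IH _ _ defL' pG1.
  exists G2; split=> //; first exact: leq_trans le1.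
    case=> [|z E1] // E2 [<- defE] _; case: E1 defE => [|z1 E1] defE.
      by apply: Qmono le2 _; rewrite /= defE in Q1.
    by rewrite rev_cons cat_rcons; apply: Q2.
  have s0 : cut_store X (y :: E) G e = enc_str y ++ SSemi :: enc_list E.
    by rewrite /cut_store; upd_at; rewrite enc_list_cons.
  have st : cut_store X (y :: E) G t = [::] by rewrite /cut_store; upd_at.
  have h0 := steps_mvtok u1 (semi_notin_enc_str y) s0 st.
  rewrite (_ : upd _ x _ = cut_store (y :: X) E G) in h0; last first.
    rewrite /cut_store; upd_at; rewrite [enc_list (y :: X)]enc_list_cons.
    by upd_eq.
  rewrite rev_cons cat_rcons.
  apply: (steps_le _ (steps_whS _ (steps_cat h0 h1) h2)); last by rewrite s0; case: (enc_str y).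
  have : size (enc_str y) <= n.
    by rewrite /n -defL size_enc_list_cat enc_list_cons size_cat /=; clear; lia.
  by clear; move=> h /=; rewrite mulSn; lia.
move=> G pG; have [G1 [pG1 le1 Q1 h1]] := hbody [::] L G erefl pG.
have [G2 [pG2 le2 Q2 h2]] := loop L [::] G1 erefl pG1; rewrite cats0 in h2.
exists G2; split=> //; first exact: leq_trans le1.
  (* The cut with an empty front is served by the run before the loop, all others by the loop. *)
  move=> X E; case/lastP: X => [|X z] defL; first by rewrite (_ : E = L) //; apply: Qmono Q1.
  have := Q2 _ _ (esym defL); rewrite revK cats0; apply.
  by rewrite -size_eq0 size_rev size_rcons.
have sx : cut_store (rev L) [::] G2 x = enc_list (rev L) by rewrite /cut_store; upd_at.
have se : cut_store (rev L) [::] G2 e = enc_list [::] by rewrite /cut_store; upd_at.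
have st : cut_store (rev L) [::] G2 t = [::] by rewrite /cut_store; upd_at.
have h3 := steps_mvtoks u2 sx se st; rewrite revK cats0 in h3.
rewrite (_ : upd _ e _ = cut_store [::] L G2) in h3; last by rewrite /cut_store; upd_eq.
apply: steps_le (steps_cat h1 (steps_cat h2 h3)).
rewrite size_enc_list_rev -/n /for_cut_time.
have := size_le_enc_list L; rewrite -/n; clear => h.
have : size L * (T + 28 * n + 20) <= n * (T + 28 * n + 20) by rewrite leq_mul2r h orbT.
by rewrite mulSn; lia.
Qed.

End ForCut.

(** * The local search program *)

Notation reg k := (@Ordinal 17 k isT).
(* E holds the tokens still to be cut; A, B, C, D hold the blocks, reversed; F is the candidate
   order, G the best one so far, N a unary bound on the number of rounds. *)
Definition rE := reg 0. Definition rA := reg 1. Definition rB := reg 2. Definition rC := reg 3.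
Definition rD := reg 4. Definition rF := reg 5. Definition rG := reg 6. Definition rU := reg 7.
Definition rT := reg 8. Definition rV := reg 9. Definition rP := reg 10. Definition rQ := reg 11.
Definition rW := reg 12. Definition rZ := reg 13. Definition rcF := reg 14. Definition rcG := reg 15.
Definition rN := reg 16.

(** With a store given by a list, updates of concrete registers simplify by computation. *)
Definition mk (l : seq (seq sym)) : store 'I_17 := fun r => nth [::] l r.

Lemma upd_mk l i v : upd (mk l) i v = mk (set_nth [::] l i v).
Proof.
by apply: functional_extensionality => r; rewrite /upd /mk nth_set_nth /= -val_eqE.
Qed.

Definition st (E A B C D F G : seq str) (N : seq sym) : store 'I_17 :=
  mk [:: enc_list E; enc_list A; enc_list B; enc_list C; enc_list D; enc_list F; enc_list G;
         [::]; [::]; [::]; [::]; [::]; [::]; [::]; [::]; [::]; N].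

Definition copy_rev x := mvtoks2 rT x rF rU ++ mvtoks rT rU x.
Definition copy_to g := mvtoks rT rE rU ++ mvtoks2 rT rU g rE.

(** The candidate grows from its back: pushing B, C, D, A onto the remainder E gives A D C B E.
    Blocks are stored reversed, and [copy_rev] undoes this. *)
Definition build := copy_to rF ++ copy_rev rB ++ copy_rev rC ++ copy_rev rD ++ copy_rev rA.

(** The unary costs are popped together, and popping an empty stack does nothing, so [rcG] stays
    nonempty exactly if the candidate is strictly cheaper. *)
Definition keep_best :=
  score rF rcF rV rP rQ rW rZ ++ score rG rcG rV rP rQ rW rZ ++
  while_ rcF isSome [:: Pop rcF; Pop rcG] ++
  cond rcG isSome (clear rG ++ mvall rF rU ++ mvall rU rG) [::] ++ clear rF ++ clear rcG.

Definition body := build ++ keep_best.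

Definition round :=
  copy_to rG ++
  for_cut rT rA rE (for_cut rT rB rE (for_cut rT rC rE (for_cut rT rD rE body))) ++
  clear rE ++ mvall rG rU ++ mvall rU rE.

(** The copy of the input on [rN] counts the rounds. The detour through [rU] at the end puts [SBar]
    after the last token; an empty [rE] yields the empty schedule. *)
Definition main :=
  while_ rE isSome (mv2 rE rU rN) ++ mvall rU rE ++
  while_ rN isSome ([:: Pop rN] ++ round) ++
  cond rE isSome (mvall rE rU ++ [:: Push rE SBar] ++ mvall rU rE) [::].

Lemma steps_eq (R : finType) (p : seq (instr R)) s s' s'' T : s' = s'' -> steps p s s' T -> steps p s s'' T.
Proof. by move=> ->. Qed.

Lemma steps_copy_to_F E A B C D F G N :
  steps (copy_to rF) (st E A B C D F G N) (st E A B C D (E ++ F) G N) (95 * size (enc_list E) + 2).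
Proof.
have h1 := @steps_mvtoks _ rT rE rU (st E A B C D F G N) E [::] isT erefl erefl erefl.
rewrite !upd_mk /= cats0 in h1.
set s1 := mk _ in h1.
have h2 := @steps_mvtoks2 _ rT rU rF rE s1 (rev E) F [::] isT erefl erefl erefl erefl.
rewrite !upd_mk /= revK cats0 size_enc_list_rev in h2.
apply: steps_le (steps_cat h1 h2); clear; lia.
Qed.

Lemma steps_copy_to_G E A B C D F N :
  steps (copy_to rG) (st E A B C D F [::] N) (st E A B C D F E N) (95 * size (enc_list E) + 2).
Proof.
have h1 := @steps_mvtoks _ rT rE rU (st E A B C D F [::] N) E [::] isT erefl erefl erefl.
rewrite !upd_mk /= cats0 in h1.
set s1 := mk _ in h1.
have h2 := @steps_mvtoks2 _ rT rU rG rE s1 (rev E) [::] [::] isT erefl erefl erefl erefl.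
rewrite !upd_mk /= revK cats0 size_enc_list_rev in h2.
apply: steps_le (steps_cat h1 h2); clear; lia.
Qed.

Lemma steps_copy_rev x s X Y : uniq [:: rT; x; rF; rU] -> s x = enc_list X -> s rF = enc_list Y ->
  s rU = [::] -> s rT = [::] ->
  steps (copy_rev x) s (upd s rF (enc_list (rev X ++ Y))) (95 * size (enc_list X) + 2).
Proof.
move=> u sx sF sU sT.
have h1 := @steps_mvtoks2 _ rT x rF rU s X Y [::] u sx sF sU sT; set s1 := upd _ rU _ in h1.
move: u; rewrite !cons_uniq !inE !negb_or => /and4P[/and3P[tx tF tU] /andP[xF xU] FU _].
have xT : x != rT by rewrite eq_sym.
have Fx : rF != x by rewrite eq_sym.
have Ux : rU != x by rewrite eq_sym.
have u2 : uniq [:: rT; rU; x] by rewrite /= !inE negb_or tU tx Ux.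
have s1U : s1 rU = enc_list (rev X) by rewrite /s1; upd_at; rewrite cats0.
have s1x : s1 x = enc_list [::] by rewrite /s1; upd_at.
have s1T : s1 rT = [::] by rewrite /s1; upd_at.
have h2 := steps_mvtoks u2 s1U s1x s1T; rewrite revK cats0 size_enc_list_rev in h2.
apply: (steps_eq _ (steps_le _ (steps_cat h1 h2))); last by clear; lia.
by rewrite /s1; upd_eq.
Qed.

Lemma steps_build E A B C D G N n :
  size (enc_list (rev A ++ rev B ++ rev C ++ rev D ++ E)) <= n ->
  steps build (st E A B C D [::] G N)
    (st E A B C D (rev A ++ rev D ++ rev C ++ rev B ++ E) G N) (95 * n + 10).
Proof.
rewrite !size_enc_list_cat !size_enc_list_rev => hn.
have h0 := steps_copy_to_F E A B C D [::] G N; rewrite cats0 in h0.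
have h1 := @steps_copy_rev rB (st E A B C D E G N) B E isT erefl erefl erefl erefl.
rewrite upd_mk /= -/(st E A B C D (rev B ++ E) G N) in h1.
have h2 := @steps_copy_rev rC (st E A B C D (rev B ++ E) G N) C _ isT erefl erefl erefl erefl.
rewrite upd_mk /= -/(st E A B C D (rev C ++ rev B ++ E) G N) in h2.
have h3 := @steps_copy_rev rD (st E A B C D (rev C ++ rev B ++ E) G N) D _ isT erefl erefl erefl erefl.
rewrite upd_mk /= -/(st E A B C D (rev D ++ rev C ++ rev B ++ E) G N) in h3.
have h4 := @steps_copy_rev rA (st E A B C D (rev D ++ rev C ++ rev B ++ E) G N) A _ isT erefl erefl erefl erefl.
rewrite upd_mk /= in h4.
apply: (steps_le _ (steps_cat h0 (steps_cat h1 (steps_cat h2 (steps_cat h3 h4))))).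
by clear -hn; lia.
Qed.

Lemma steps_pop_both (s : store 'I_17) x y : s rcF = x ->
  s rcG = y -> steps (while_ rcF isSome [:: Pop rcF; Pop rcG]) s
    (upd (upd s rcF [::]) rcG (drop (size x) y)) (4 * size x + 1).
Proof.
elim: x y s => [|a x IH] y s sF sG.
  by apply: steps_eq (steps_wh0 _ _); rewrite ?sF // drop0 -sF -sG; upd_eq.
pose s1 := upd (upd s rcF x) rcG (behead y).
have h1 : steps [:: Pop rcF; Pop rcG] s s1 2.
  apply: (steps_cat (T1 := 1) (p := [:: _])); first exact: steps_pop.
  by apply: steps_eq (steps_pop _ _); rewrite sF /s1 -sG /=; congr (upd _ _ _).
apply: (steps_le _ (steps_eq _ (steps_whS _ h1 (IH (behead y) s1 _ _)))).
- by rewrite /=; clear; lia.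
- by rewrite /s1 /= (_ : drop _ (behead y) = drop (size x).+1 y); [upd_eq | case: (y)].
- by rewrite sF.
- by [].
- by [].
Qed.

Lemma steps_keep_best E A B C D F G N n : size (enc_list F) <= n -> size (enc_list G) <= n ->
  exists G', [/\ G' = F \/ G' = G, batch_cost G' <= batch_cost G, batch_cost G' <= batch_cost F &
   steps keep_best (st E A B C D F G N) (st E A B C D [::] G' N) (600 * n + 50)].
Proof.
move=> hF hG; set s0 := st E A B C D F G N.
have h1 := @steps_score _ rF rcF rV rP rQ rW rZ s0 F isT erefl erefl erefl erefl erefl erefl.
rewrite upd_mk /= cats0 in h1; set s1 := mk _ in h1.
have h2 := @steps_score _ rG rcG rV rP rQ rW rZ s1 G isT erefl erefl erefl erefl erefl erefl.
rewrite upd_mk /= cats0 in h2; set s2 := mk _ in h2.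
have h3 := @steps_pop_both s2 _ _ erefl erefl.
rewrite !upd_mk /= size_nseq in h3; set s3 := mk _ in h3.
have cF := batch_cost_le F; have cG := batch_cost_le G.
pose G' := if batch_cost F < batch_cost G then F else G.
(* The content left on [rF]: a winning candidate has been moved away to [rG]. *)
pose F' := if batch_cost F < batch_cost G then [::] else F.
pose d := nseq (batch_cost G - batch_cost F) S0.
pose s4 := mk [:: enc_list E; enc_list A; enc_list B; enc_list C; enc_list D; enc_list F';
  enc_list G'; [::]; [::]; [::]; [::]; [::]; [::]; [::]; [::]; d; N].
have drop_nseq : drop (batch_cost F) (nseq (batch_cost G) S0) = d.
  rewrite /d; elim: (batch_cost F) (batch_cost G) => [|a IH] [|b] //=.
have h4 : steps (cond rcG isSome (clear rG ++ mvall rF rU ++ mvall rU rG) [::]) s3 s4 (27 * n + 5).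
  have s3G : s3 rcG = d by rewrite -drop_nseq.
  rewrite (_ : 27 * n + 5 = 27 * n + 3 + 2); last by clear; lia.
  apply: steps_cond; rewrite s3G /s4 /d /G' /F'.
  case: ltnP => h; last first.
    have e : batch_cost G - batch_cost F = 0 by clear -h; lia.
    rewrite e /=; apply: (steps_le (T := 0)) => //; apply: steps_eq (steps_nil _).
    by rewrite /s3 drop_nseq /d e.
  have -> : isSome (ohead (nseq (batch_cost G - batch_cost F) S0)).
    by rewrite -subn_gt0 in h; case: (_ - _) h.
  have k1 := steps_clear rG s3; rewrite upd_mk /= in k1; set s5 := mk _ in k1.
  have k2 := @steps_mvall _ rF rU s5 isT; rewrite !upd_mk /= cats0 in k2; set s6 := mk _ in k2.
  have k3 := @steps_mvall _ rU rG s6 isT; rewrite !upd_mk /= cats0 revK in k3.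
  apply: (steps_le _ (steps_eq _ (steps_cat k1 (steps_cat k2 k3)))).
    rewrite size_rev (_ : s3 rG = enc_list G) // (_ : s5 rF = enc_list F) //.
    by clear -hF hG; lia.
  by rewrite (_ : s5 rF = enc_list F) // (_ : s2 rcG = nseq (batch_cost G) S0) // drop_nseq.
have h5 := steps_clear rF s4; rewrite upd_mk /= in h5; set s5 := mk _ in h5.
have h6 := steps_clear rcG s5; rewrite upd_mk /= in h6.
exists G'; split.
- by rewrite /G'; case: ifP; [left|right].
- by rewrite /G'; case: ltnP => // /ltnW.
- by rewrite /G'; case: ltnP.
apply: (steps_le _ (steps_cat h1 (steps_cat h2 (steps_cat h3 (steps_cat h4 (steps_cat h5 h6)))))).
have hF' : size (enc_list F') <= n by rewrite /F'; case: ifP.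
have hd : size d <= n by rewrite size_nseq; clear -cG hG; lia.
have -> : s4 rF = enc_list F' by [].
have -> : s5 rcG = d by [].
clear -hF' hd hF hG cF cG; lia.
Qed.

Lemma steps_body L E A B C D G N : rev A ++ rev B ++ rev C ++ rev D ++ E = L ->
  perm_eq G L -> exists G',
  [/\ perm_eq G' L, batch_cost G' <= batch_cost G,
      batch_cost G' <= batch_cost (rev A ++ rev D ++ rev C ++ rev B ++ E) &
      steps body (st E A B C D [::] G N) (st E A B C D [::] G' N)
        (700 * size (enc_list L) + 60)].
Proof.
move=> defL pG; set F := rev A ++ rev D ++ rev C ++ rev B ++ E.
have pF : perm_eq F L.
  by rewrite /F -defL; apply/permP => P; rewrite !count_cat; clear; lia.
have h1 := @steps_build E A B C D G N (size (enc_list L)); rewrite defL in h1.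
have [|| G' [G'E le1 le2 h2]] := @steps_keep_best E A B C D F G N (size (enc_list L)).
- by rewrite (size_enc_list_perm pF).
- by rewrite (size_enc_list_perm pG).
exists G'; split=> //; first by case: G'E => ->.
by apply: (steps_le _ (steps_cat (h1 (leqnn _)) h2)); clear; lia.
Qed.

Lemma for_cut_time_mono m n T : m <= n -> for_cut_time m T <= for_cut_time n T.
Proof. by move=> mn; rewrite /for_cut_time leq_add2r leq_add ?leq_mul //; clear -mn; lia. Qed.

Lemma steps_cutD L E A B C G N : rev A ++ rev B ++ rev C ++ E = L ->
  perm_eq G L -> exists G',
  [/\ perm_eq G' L, batch_cost G' <= batch_cost G,
      forall D E', rev D ++ E' = E ->
      batch_cost G' <= batch_cost (rev A ++ rev D ++ rev C ++ rev B ++ E') &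
      steps (for_cut rT rD rE body) (st E A B C [::] [::] G N) (st E A B C [::] [::] G' N)
        (for_cut_time (size (enc_list L)) (700 * size (enc_list L) + 60))].
Proof.
move=> defL pG.
have cutE X Y Z : cut_store rD rE rG (st [::] A B C [::] [::] [::] N) X Y Z = st Y A B C X [::] Z N.
  by rewrite /cut_store !upd_mk.
have [|X Y Z defE pZ|G' [pG' le Q h]] := @steps_for_cut _ rT rD rE rG isT (st [::] A B C [::] [::] [::] N)
  erefl body (700 * size (enc_list L) + 60) E L
  (fun D E' m => m <= batch_cost (rev A ++ rev D ++ rev C ++ rev B ++ E')) _ _ G pG.
- by move=> X Y m m' le; apply: leq_trans.
- have eqL : rev A ++ rev B ++ rev C ++ rev X ++ Y = L by rewrite -?defL -defE.
  by have [G' [? ? ? ?]] := steps_body N eqL pZ; exists G'; rewrite !cutE.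
exists G'; split=> //; rewrite !cutE in h; apply: steps_le h.
by apply: for_cut_time_mono; rewrite -defL !size_enc_list_cat; clear; lia.
Qed.

Lemma steps_cutC L E A B G N T : rev A ++ rev B ++ E = L ->
  T = for_cut_time (size (enc_list L)) (700 * size (enc_list L) + 60) ->
  perm_eq G L -> exists G',
  [/\ perm_eq G' L, batch_cost G' <= batch_cost G,
      forall C D E', rev C ++ rev D ++ E' = E ->
      batch_cost G' <= batch_cost (rev A ++ rev D ++ rev C ++ rev B ++ E') &
      steps (for_cut rT rC rE (for_cut rT rD rE body))
        (st E A B [::] [::] [::] G N) (st E A B [::] [::] [::] G' N)
        (for_cut_time (size (enc_list L)) T)].
Proof.
move=> defL -> pG.
have cutE X Y Z : cut_store rC rE rG (st [::] A B [::] [::] [::] [::] N) X Y Z =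
    st Y A B X [::] [::] Z N by rewrite /cut_store !upd_mk.
have [|X Y Z defE pZ|G' [pG' le Q h]] := @steps_for_cut _ rT rC rE rG isT (st [::] A B [::] [::] [::] [::] N)
  erefl (for_cut rT rD rE body)
  (for_cut_time (size (enc_list L)) (700 * size (enc_list L) + 60)) E L
  (fun C E1 m => forall D E', rev D ++ E' = E1 ->
     m <= batch_cost (rev A ++ rev D ++ rev C ++ rev B ++ E')) _ _ G pG.
- by move=> X Y m m' le h D E' /h; apply: leq_trans.
- have eqL : rev A ++ rev B ++ rev X ++ Y = L by rewrite -?defL -defE.
  by have [G' [? ? ? ?]] := steps_cutD N eqL pZ; exists G'; rewrite !cutE.
exists G'; split=> //; first by move=> C D E' defE; apply: Q defE _ _ erefl.
rewrite !cutE in h; apply: steps_le h.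
by apply: for_cut_time_mono; rewrite -defL !size_enc_list_cat; clear; lia.
Qed.

Lemma steps_cutB L E A G N T : rev A ++ E = L ->
  T = for_cut_time (size (enc_list L)) (for_cut_time (size (enc_list L)) (700 * size (enc_list L) + 60)) ->
  perm_eq G L -> exists G',
  [/\ perm_eq G' L, batch_cost G' <= batch_cost G,
      forall B C D E', rev B ++ rev C ++ rev D ++ E' = E ->
      batch_cost G' <= batch_cost (rev A ++ rev D ++ rev C ++ rev B ++ E') &
      steps (for_cut rT rB rE (for_cut rT rC rE (for_cut rT rD rE body)))
        (st E A [::] [::] [::] [::] G N) (st E A [::] [::] [::] [::] G' N)
        (for_cut_time (size (enc_list L)) T)].
Proof.
move=> defL -> pG.
have cutE X Y Z : cut_store rB rE rG (st [::] A [::] [::] [::] [::] [::] N) X Y Z =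
    st Y A X [::] [::] [::] Z N by rewrite /cut_store !upd_mk.
have [|X Y Z defE pZ|G' [pG' le Q h]] := @steps_for_cut _ rT rB rE rG isT (st [::] A [::] [::] [::] [::] [::] N)
  erefl (for_cut rT rC rE (for_cut rT rD rE body))
  (for_cut_time (size (enc_list L)) (for_cut_time (size (enc_list L)) (700 * size (enc_list L) + 60))) E L
  (fun B E1 m => forall C D E', rev C ++ rev D ++ E' = E1 ->
     m <= batch_cost (rev A ++ rev D ++ rev C ++ rev B ++ E')) _ _ G pG.
- by move=> X Y m m' le h C D E' /h; apply: leq_trans.
- have eqL : rev A ++ rev X ++ Y = L by rewrite -?defL -defE.
  by have [G' [? ? ? ?]] := steps_cutC N eqL erefl pZ; exists G'; rewrite !cutE.
exists G'; split=> //; first by move=> B C D E' defE; apply: Q defE _ _ _ erefl.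
rewrite !cutE in h; apply: steps_le h.
by apply: for_cut_time_mono; rewrite -defL !size_enc_list_cat; clear; lia.
Qed.

Definition cuts_time n := for_cut_time n (for_cut_time n (for_cut_time n (for_cut_time n (700 * n + 60)))).

Lemma steps_cutA L N : exists G',
  [/\ perm_eq G' L, batch_cost G' <= batch_cost L,
      forall A B C D E, L = A ++ B ++ C ++ D ++ E ->
      batch_cost G' <= batch_cost (A ++ D ++ C ++ B ++ E) &
      steps (for_cut rT rA rE (for_cut rT rB rE (for_cut rT rC rE (for_cut rT rD rE body))))
        (st L [::] [::] [::] [::] [::] L N) (st L [::] [::] [::] [::] [::] G' N)
        (cuts_time (size (enc_list L)))].
Proof.
have cutE X Y Z : cut_store rA rE rG (st [::] [::] [::] [::] [::] [::] [::] N) X Y Z =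
    st Y X [::] [::] [::] [::] Z N by rewrite /cut_store !upd_mk.
have [|X Y Z defE pZ|G' [pG' le Q h]] := @steps_for_cut _ rT rA rE rG isT (st [::] [::] [::] [::] [::] [::] [::] N)
  erefl (for_cut rT rB rE (for_cut rT rC rE (for_cut rT rD rE body)))
  (for_cut_time (size (enc_list L)) (for_cut_time (size (enc_list L))
    (for_cut_time (size (enc_list L)) (700 * size (enc_list L) + 60)))) L L
  (fun A E1 m => forall B C D E', rev B ++ rev C ++ rev D ++ E' = E1 ->
     m <= batch_cost (rev A ++ rev D ++ rev C ++ rev B ++ E')) _ _ L (perm_refl _).
- by move=> X Y m m' le h B C D E' /h; apply: leq_trans.
- have eqL : rev X ++ Y = L by rewrite -?defL -defE.
  by have [G' [? ? ? ?]] := steps_cutB N eqL erefl pZ; exists G'; rewrite !cutE.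
exists G'; split=> //; last by rewrite !cutE in h.
move=> A B C D E defL.
have := Q (rev A) (B ++ C ++ D ++ E); rewrite revK => /(_ (esym defL)) /(_ (rev B) (rev C) (rev D) E).
by rewrite !revK; apply.
Qed.

Lemma steps_round L N : exists L',
  [/\ perm_eq L' L, batch_cost L' <= batch_cost L,
      forall A B C D E, L = A ++ B ++ C ++ D ++ E ->
      batch_cost L' <= batch_cost (A ++ D ++ C ++ B ++ E) &
      steps round (st L [::] [::] [::] [::] [::] [::] N) (st L' [::] [::] [::] [::] [::] [::] N)
        (cuts_time (size (enc_list L)) + 122 * size (enc_list L) + 5)].
Proof.
have [L' [pL' le Q h2]] := steps_cutA L N; exists L'; split=> //.
have h1 := steps_copy_to_G L [::] [::] [::] [::] [::] N.
set s1 := st L _ _ _ _ _ L' N in h2.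
have h3 := steps_clear rE s1; rewrite upd_mk /= in h3; set s2 := mk _ in h3.
have h4 := @steps_mvall _ rG rU s2 isT; rewrite !upd_mk /= cats0 in h4; set s3 := mk _ in h4.
have h5 := @steps_mvall _ rU rE s3 isT; rewrite !upd_mk /= cats0 revK in h5.
apply: (steps_le _ (steps_cat h1 (steps_cat h2 (steps_cat h3 (steps_cat h4 h5))))).
rewrite size_rev (_ : s1 rE = enc_list L) // (_ : s2 rG = enc_list L') //.
by rewrite (size_enc_list_perm pL'); move: (cuts_time _); clear; lia.
Qed.

Lemma steps_rounds N L : exists L',
  [/\ perm_eq L' L, batch_cost L' <= batch_cost L,
      batch_cost L' + size N <= batch_cost L \/
        (forall Y, perm_eq Y L -> batch_cost L' <= batch_cost Y) &
      steps (while_ rN isSome ([:: Pop rN] ++ round))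
        (st L [::] [::] [::] [::] [::] [::] N) (st L' [::] [::] [::] [::] [::] [::] [::])
        (size N * (cuts_time (size (enc_list L)) + 122 * size (enc_list L) + 8) + 1)].
Proof.
elim: N L => [|a N IH] L.
  by exists L; split=> //; [left; rewrite addn0 | apply: steps_wh0].
have [L1 [p1 le1 Q1 h1]] := steps_round L N; have [L' [p' le' Q' h']] := IH L1.
have h0 := steps_pop rN (st L [::] [::] [::] [::] [::] [::] (a :: N)); rewrite upd_mk /= in h0.
exists L'; split.
- exact: perm_trans p' p1.
- exact: leq_trans le' le1.
(* A round without gain shows that no move improves [L], so its cost is already the global minimum.
   Otherwise the spent unit of the counter is matched by a drop of the cost. *)
- have [eq|ne] := eqVneq (batch_cost L1) (batch_cost L).
    right=> Y pY; apply: leq_trans le' (leq_trans le1 _).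
    apply: batch_locally_optimal_le => // A B C D E /Q1; by rewrite eq.
  case: Q' => [l|Q']; first by left; rewrite /=; clear -l le1 ne; lia.
  by right=> Y pY; apply: Q'; apply: perm_trans pY _; rewrite perm_sym.
apply: (steps_le _ (steps_whS _ (steps_cat h0 h1) h')) => //.
by rewrite (size_enc_list_perm p1) /= mulSn; move: (cuts_time _); clear=> c; nia.
Qed.

Definition main_time n := n * (cuts_time n + 122 * n + 8) + 60 * n + 10.

Lemma steps_main X : exists L,
  [/\ perm_eq L X, forall Y, perm_eq Y X -> batch_cost L <= batch_cost Y &
      exists2 s', s' rE = enc_sched (single_batch L) &
      steps main (upd (fun=> [::]) rE (enc_list X)) s' (main_time (size (enc_list X)))].
Proof.
set n := size (enc_list X).
have -> : upd (fun=> [::]) rE (enc_list X) = st X [::] [::] [::] [::] [::] [::] [::].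
  apply: functional_extensionality => -[r rlt]; rewrite /upd /st /mk /= -val_eqE /=.
  by do 17 (case: r rlt => [|r] rlt //).
set s0 := st X _ _ _ _ _ _ _.
have h1 : steps (while_ rE isSome (mv2 rE rU rN)) s0 _ _ :=
  @steps_mv2_while _ rE rU rN isSome s0 (enc_list X) [::] isT isT isT (stops_some _) (esym (cats0 _)).
rewrite !upd_mk /= !cats0 in h1; set s1 := mk _ in h1.
have h2 := @steps_mvall _ rU rE s1 isT; rewrite !upd_mk /= cats0 revK in h2.
have [L [pL le Q h3]] := steps_rounds (rev (enc_list X)) X.
rewrite (_ : st X _ _ _ _ _ _ _ = mk
   [:: enc_list X; [::]; [::]; [::]; [::]; [::]; [::]; [::]; [::]; [::]; [::]; [::]; [::]; [::]; [::]; [::];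
     rev (enc_list X)]) // in h3.
exists L; split=> //.
  (* If the cost dropped by the whole length of the input, which bounds the initial cost, it is now
     0. *)
  case: Q => // + Y pY; rewrite size_rev => l.
  by have := batch_cost_le X; clear -l; lia.
have nL : size (enc_list L) = n by apply: size_enc_list_perm.
have s1U : s1 rU = rev (enc_list X) by [].
rewrite s1U !size_rev -/n in h2 h3.
set s3 := st L _ _ _ _ _ _ _ in h3; have s3E : s3 rE = enc_list L by [].
have [L0|Ln] := eqVneq L [::].
  exists s3; first by rewrite s3E L0.
  have h4 : steps (cond rE isSome (mvall rE rU ++ [:: Push rE SBar] ++ mvall rU rE) [::]) s3 s3 2.
    by apply: (steps_cond (T := 0)); rewrite s3E L0; apply: steps_nil.
  apply: (steps_le _ (steps_cat h1 (steps_cat h2 (steps_cat h3 h4)))).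
  by rewrite /main_time -/n; move: (cuts_time n) => c; clear; nia.
have k1 := @steps_mvall _ rE rU s3 isT; rewrite !upd_mk /= cats0 in k1; set s4 := mk _ in k1.
have k2 := steps_push rE SBar s4; rewrite upd_mk /= in k2; set s5 := mk _ in k2.
have k3 := @steps_mvall _ rU rE s5 isT; rewrite !upd_mk /= revK in k3; set s6 := mk _ in k3.
have h4 : steps (cond rE isSome (mvall rE rU ++ [:: Push rE SBar] ++ mvall rU rE) [::]) s3 s6
    (24 * n + 3 + 2).
  apply: steps_cond; rewrite s3E.
  have -> : isSome (ohead (enc_list L)).
    by case: (L) Ln => // x L1 _; rewrite enc_list_cons; case: (enc_str x).
  apply: (steps_le _ (steps_cat k1 (steps_cat k2 k3))).
  rewrite (_ : s5 rU = rev (enc_list L)) // size_rev s3E nL.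
  by clear; lia.
exists s6; first (have -> : s6 rE = enc_list L ++ [:: SBar] by []).
  by case: (L) Ln => // x L1 _; rewrite /enc_sched /= cats0.
apply: (steps_le _ (steps_cat h1 (steps_cat h2 (steps_cat h3 h4)))).
by rewrite /main_time -/n; move: (cuts_time n) => c; clear; nia.
Qed.

(** * Polynomial time bounds *)

Lemma for_cut_time_poly n c k T : T <= c * n.+1 ^ k.+1 ->
  for_cut_time n T <= (c + 100) * n.+1 ^ k.+2.
Proof.
move=> hT; set N := n.+1 ^ k.+1; have N1 : n < N.
  by rewrite /N expnS leq_pmulr // expn_gt0.
rewrite [n.+1 ^ k.+2]expnS -/N /for_cut_time.
have : n.+1 * (T + 28 * n + 20) <= n.+1 * ((c + 48) * N).
  by rewrite leq_mul2l /=; rewrite -/N in hT; clear -hT N1; nia.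
have : N <= n.+1 * N by rewrite leq_pmull.
by move: (n.+1 * N) (mulnCA n.+1 (c + 48) N) => M -> h1 h2; clear -h1 h2 N1; nia.
Qed.

(** Each of the four nested loops raises the degree of the linear body by one, and the rounds raise
    it to 6. The constant is 700 from the body, 100 per loop and 200 for the rest. *)
Lemma main_time_poly : exists c, forall n, main_time n <= c * n.+1 ^ 6.
Proof.
exists (700 + 100 + 100 + 100 + 100 + 200) => n.
have h0 : 700 * n + 60 <= 700 * n.+1 ^ 1 by rewrite expn1; clear; lia.
have := for_cut_time_poly (for_cut_time_poly (for_cut_time_poly (for_cut_time_poly h0))).
rewrite -/(cuts_time n) /main_time; move: (cuts_time n) (700 + _ + _ + _ + _) => T c hT.
have N1 : n < n.+1 ^ 5 by rewrite (expnS _ 4) leq_pmulr // expn_gt0.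
rewrite (expnS _ 5); move: (n.+1 ^ 5) hT N1 => N hT N1.
have : n * (T + 122 * n + 8) <= n * ((c + 130) * N) by rewrite leq_mul2l; clear -hT N1; nia.
have : n < n.+1 * N by clear -N1; nia.
by clear; nia.
Qed.

Theorem theorem2 : exists M : TM, solves_schedule_in_poly_time M.
Proof.
exists (machine rE main); have [c hc] := main_time_poly.
(* With [N = n.+1 ^ 6] and [m <= c * N], the simulation time [m * (2 * (n + m) + 6) + n + m + 4] is
   quadratic in [N], which gives this coefficient and the exponent 12. *)
exists (2 * c * c + 9 * c + 5), 12 => X _.
have [L [pL opt [s' outE /steps_start[m mle hm]]]] := steps_main X.
have [t tle [halted out]] := machine_correct hm; exists t; split; last split=> //.
  apply: leq_trans tle _; move: mle (hc (size (enc_list X))).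
  set n := size _ => mle hn; have {mle hn} hm' := leq_trans mle hn.
  have N1 : n < n.+1 ^ 6 by rewrite (expnS _ 5) leq_pmulr // expn_gt0.
  rewrite (expnM _ 6 2); move: (n.+1 ^ 6) hm' N1 => N hm' N1.
  have h1 : m * (2 * (n + m) + 6) <= c * N * (2 * (N + c * N) + 6 * N).
    by apply: leq_mul => //; clear -hm' N1; lia.
  by clear -h1 hm' N1; nia.
by exists (single_batch L); split; [rewrite out | apply: single_batch_optimal].
Qed.
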